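(* Let $\{K^{(n)}_{\cdot}(\cdot,\cdot)\}_{n\in\mathbb{N}^+}$ be a family of functions $K^{(n)}:\overline{\mathcal{S}}^{++}(\mathbb{C}^n)\times\mathcal{B}(\mathbb{C}^n)\times\mathcal{B}(\mathbb{C}^n)\to\mathbb{C}$, $(\rho,X,Y)\mapsto K^{(n)}_\rho(X,Y)$. Then $\{K^{(n)}_{\cdot}(\cdot,\cdot)\}_{n\in\mathbb{N}^+}$ is a family of CPTNI monotone metrics if and only if there exists an operator monotone function $f:(0,\infty)\to(0,\infty)$ such that $$K^{(n)}_{\rho}(X,Y)=\operatorname{Tr} X^{*}\left[\left(\mathbf{R}_{\rho}\, f(\mathbf{L}_{\rho}\mathbf{R}_{\rho}^{-1})\right)^{-1}Y\right]$$ for all $n\in\mathbb{N}^+$, $\rho\in\overline{\mathcal{S}}^{++}(\mathbb{C}^n)$, and $X,Y\in\mathcal{B}(\mathbb{C}^n)$.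
   Context: Notation. $\mathbb{N}^+$ is the set of positive integers and $\mathcal{B}(\mathbb{C}^n)$ is the set of all linear operators on $\mathbb{C}^n$. Set $\overline{\mathcal{S}}^{++}(\mathbb{C}^n)=\{\rho\in\mathcal{B}(\mathbb{C}^n)\mid \operatorname{Tr}\rho\le 1,\ \rho>0\}$ (strictly positive operators of trace at most one) and $\overline{\mathcal{S}}(\mathbb{C}^n)=\{\rho\in\mathcal{B}(\mathbb{C}^n)\mid \operatorname{Tr}\rho\le 1,\ \rho\ge 0\}$. A CPTNI (completely positive, trace non-increasing) map $T:\mathcal{B}(\mathbb{C}^n)\to\mathcal{B}(\mathbb{C}^m)$ is a map of the form $T(X)=\sum_{i=1}^k A_iXA_i^*$ with linear maps $A_1,\dots,A_k:\mathbb{C}^n\to\mathbb{C}^m$ such that $\sum_{i=1}^k A_i^*A_i\le I$. The set of all of them is denoted $\overline{\mathcal{C}}(\mathbb{C}^n,\mathbb{C}^m)$. A family of functions $\{K^{(n)}_{\cdot}(\cdot,\cdot)\}_{n\in\mathbb{N}^+}$ from $\overline{\mathcal{S}}^{++}(\mathbb{C}^n)\times\mathcal{B}(\mathbb{C}^n)\times\mathcal{B}(\mathbb{C}^n)$ to $\mathbb{C}$ is a family of CPTNI monotone metrics if: (a) for every $n\in\mathbb{N}^+$ and $\rho\in\overline{\mathcal{S}}^{++}(\mathbb{C}^n)$, the map $(X,Y)\mapsto K^{(n)}_\rho(X,Y)$ is a (complex, positive definite) inner product on $\mathcal{B}(\mathbb{C}^n)$, conjugate-linear in the first argument and linear in the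 second; (b) for every $n,m\in\mathbb{N}^+$, $T\in\overline{\mathcal{C}}(\mathbb{C}^n,\mathbb{C}^m)$, $X\in\mathcal{B}(\mathbb{C}^n)$, $\rho\in\overline{\mathcal{S}}^{++}(\mathbb{C}^n)$, and $\sigma\in\overline{\mathcal{S}}(\mathbb{C}^m)$ such that $T(\rho)+\sigma\in\overline{\mathcal{S}}^{++}(\mathbb{C}^m)$, one has $K^{(m)}_{T(\rho)+\sigma}(T(X),T(X))\le K^{(n)}_\rho(X,X)$. No continuity in $\rho$ is assumed. For a strictly positive operator $\rho$ on $\mathbb{C}^n$, $\mathbf{L}_\rho$ and $\mathbf{R}_\rho$ are the linear operators on $\mathcal{B}(\mathbb{C}^n)$ given by $\mathbf{L}_\rho(X)=\rho X$ and $\mathbf{R}_\rho(X)=X\rho$. They are commuting strictly positive operators with respect to the Hilbert–Schmidt inner product $(X,Y)\mapsto\operatorname{Tr}X^*Y$, and $f(\mathbf{L}_\rho\mathbf{R}_\rho^{-1})$ is defined by functional calculus. A function $f:(0,\infty)\to(0,\infty)$ is operator monotone if for all operators $A,B$ (on $\mathbb{C}^n$, for every $n$), $0<A\le B$ implies $0<f(A)\le f(B)$. *)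

(* Defs.v *)
From HB Require Import structures.
From mathcomp Require Import all_boot all_order all_algebra.
From mathcomp Require Import reals complex.

Set Implicit Arguments.
Unset Strict Implicit.
Unset Printing Implicit Defensive.

Import Order.TTheory GRing.Theory Num.Theory.
Local Open Scope ring_scope.
Local Open Scope sesquilinear_scope.

(* An operator C^n -> C^m is an m x n matrix over R[i] acting on column
   vectors, and A^t* is the adjoint of A.  The order of R[i] is
   z <= w iff w - z is a nonnegative real. *)

Section Operators.
Context {R : realType}.
Local Notation C := R[i].

(* The quadratic form is in particular required to be real-valued, which over
   the complex numbers forces A to be self-adjoint. *)
Definition psd n (A : 'M[C]_n) : Prop :=
  forall x : 'cV[C]_n, 0 <= (x^t* *m A *m x) 0 0.

Definition pd n (A : 'M[C]_n) : Prop :=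
  forall x : 'cV[C]_n, x != 0 -> 0 < (x^t* *m A *m x) 0 0.

Definition loewner_le n (A B : 'M[C]_n) : Prop := psd (B - A).

Definition substate n (rho : 'M[C]_n) : Prop := \tr rho <= 1 /\ psd rho.

Definition pos_substate n (rho : 'M[C]_n) : Prop := \tr rho <= 1 /\ pd rho.

Definition cptni n m (T : 'M[C]_n -> 'M[C]_m) : Prop :=
  exists (k : nat) (A : 'I_k -> 'M[C]_(m, n)),
    loewner_le (\sum_i (A i)^t* *m A i) 1%:M /\
    forall X, T X = \sum_i A i *m X *m (A i)^t*.

Definition complex_inner_product n
    (g : 'M[C]_n -> 'M[C]_n -> C) : Prop :=
  [/\ forall a X Y Z, g X (a *: Y + Z) = a * g X Y + g X Z,
      forall a X Y Z, g (a *: X + Y) Z = a^* * g X Z + g Y Z,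
      forall X Y, g Y X = (g X Y)^*
    & forall X, X != 0 -> 0 < g X X].

(* Only the values K n rho with 0 < n and rho a positive substate are
   constrained; they are the only ones that are meaningful. *)
Definition cptni_monotone_metrics
    (K : forall n, 'M[C]_n -> 'M[C]_n -> 'M[C]_n -> C) : Prop :=
  (forall n (rho : 'M[C]_n), (0 < n)%N -> pos_substate rho ->
     complex_inner_product (K n rho)) /\
  (forall n m (T : 'M[C]_n -> 'M[C]_m) (X rho : 'M[C]_n) (sigma : 'M[C]_m),
     (0 < n)%N -> (0 < m)%N -> cptni T ->
     pos_substate rho -> substate sigma -> pos_substate (T rho + sigma) ->
     K m (T rho + sigma) (T X) (T X) <= K n rho X X).

(* Functional calculus of a self-adjoint A = P^-1 *m diag_mx d *m P, where
   P = spectralmx A is unitary and the entries of d = spectral_diag A are the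
   (real) eigenvalues of A. *)
Definition funcalc (f : R -> R) n (A : 'M[C]_n) : 'M[C]_n :=
  invmx (spectralmx A)
    *m diag_mx (map_mx (fun z : C => (f (complex.Re z))%:C%C) (spectral_diag A))
    *m spectralmx A.

(* A function (0, oo) -> (0, oo) is given by a function on R, whose values
   outside (0, oo) are irrelevant. *)
Definition operator_monotone (f : R -> R) : Prop :=
  (forall x, 0 < x -> 0 < f x) /\
  (forall n (A B : 'M[C]_n), (0 < n)%N -> pd A -> loewner_le A B ->
     pd (funcalc f A) /\ loewner_le (funcalc f A) (funcalc f B)).

(* A linear operator on 'M[C]_n is encoded as the matrix S acting by right
   multiplication on the row vectors mxvec Y; hence S1 *m S2 encodes "S1, then
   S2".  Since mxvec identifies the Hilbert-Schmidt inner product with the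
   standard one, funcalc applied to S is the functional calculus with respect
   to the Hilbert-Schmidt inner product. *)
Definition superapp n (S : 'M[C]_(n * n)) (Y : 'M[C]_n) : 'M[C]_n :=
  vec_mx (mxvec Y *m S).

Definition Lop n (rho : 'M[C]_n) : 'M[C]_(n * n) := lin_mulmx rho.

Definition Rop n (rho : 'M[C]_n) : 'M[C]_(n * n) := lin_mulmxr rho.

Definition modop n (rho : 'M[C]_n) : 'M[C]_(n * n) :=
  invmx (Rop rho) *m Lop rho.

Definition metric_op (f : R -> R) n (rho : 'M[C]_n) : 'M[C]_(n * n) :=
  funcalc f (modop rho) *m Rop rho.

Lemma superapp_Lop n (rho Y : 'M[C]_n) : superapp (Lop rho) Y = rho *m Y.
Proof. by rewrite /superapp /Lop /lin_mulmx mul_vec_lin mxvecK. Qed.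

Lemma superapp_Rop n (rho Y : 'M[C]_n) : superapp (Rop rho) Y = Y *m rho.
Proof. by rewrite /superapp /Rop /lin_mulmxr mul_vec_lin mxvecK. Qed.

Lemma superappM n (S1 S2 : 'M[C]_(n * n)) (Y : 'M[C]_n) :
  superapp (S1 *m S2) Y = superapp S2 (superapp S1 Y).
Proof. by rewrite /superapp vec_mxK mulmxA. Qed.

Lemma superapp_modop n (rho Y : 'M[C]_n) : rho \in unitmx ->
  superapp (modop rho) Y = rho *m Y *m invmx rho.
Proof.
move=> rho_unit.
have RVR : Rop (invmx rho) *m Rop rho = 1%:M.
  apply/row_matrixP => i; rewrite !rowE; set v := delta_mx 0 i.
  rewrite mulmx1 -[v]vec_mxK mulmxA /Rop /lin_mulmxr.
  by rewrite mul_vec_lin /= mul_vec_lin /= mulmxKV.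
have [_ R_unit] := mulmx1_unit RVR.
have RV : invmx (Rop rho) = Rop (invmx rho).
  by rewrite -[invmx _]mul1mx -RVR mulmxK.
by rewrite /modop RV superappM superapp_Rop superapp_Lop mulmxA.
Qed.

Lemma mxtrace_mxvec n (X Y : 'M[C]_n) :
  \tr (X^t* *m Y) = (mxvec Y *m (mxvec X)^t*) 0 0.
Proof.
rewrite !mxE (reindex _ (curry_mxvec_bij n n)) /=.
rewrite (eq_bigr (fun p : 'I_n * 'I_n => Y p.1 p.2 * (X p.1 p.2)^*)); last first.
  by case=> i j _; rewrite !mxE !mxvecE.
rewrite -(pair_bigA _ (fun i j => Y i j * (X i j)^*)) exchange_big /=.
apply: eq_bigr => j _; rewrite !mxE; apply: eq_bigr => i _.
by rewrite !mxE mulrC.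
Qed.

End Operators.

(* Main.v *)
Require Import Defs.
From HB Require Import structures.
From mathcomp Require Import all_boot all_order all_algebra.
From mathcomp Require Import reals complex ring.

Set Implicit Arguments.
Unset Strict Implicit.
Unset Printing Implicit Defensive.

Import Order.TTheory GRing.Theory Num.Theory.
Local Open Scope ring_scope.
Local Open Scope sesquilinear_scope.

(* Sufficiency is Petz's argument.  In eigenbases of rho and omega = T(rho) + sigma
   the operators L, R and J = R f(L R^-1) are diagonal.  The Kadison-Schwarz
   inequality gives T L_rho T^* <= L_omega and T R_rho T^* <= R_omega, hence by
   Hansen's inequality for f the same holds for J, and inverting
   T J_rho T^* <= J_omega gives T^* J_omega^-1 T <= J_rho^-1.

   Necessity.  The maps X |-> V X V^* and Y |-> V^* Y V show that the metric at rho
   restricts to reducing subspaces and that direct sums are orthogonal.  Splitting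
   X into s X (+) (1 - s) X and merging back shows that t |-> K_(t rho)(t X, t X) is
   additive; being nonnegative it is linear, so K is homogeneous of degree -1 in
   rho without any continuity assumption.  Pinchings and diagonal unitaries then
   diagonalize K at a diagonal rho, with the weight at (i, j) depending only on
   (p_i, p_j), which defines f.  Finally f is operator monotone because K at A (+) 1
   in the corner direction x is the quadratic form of f(A)^-1 at x, and K_rho
   decreases when rho grows. *)

(** * Hermitian forms and the spectral theorem *)

(** Limits are taken as inequalities holding for every factor [k > 1]. The dilation behind the
    inequality of Hansen needs such slack. It is removed afterwards by [g (k x) <= k g x], itself
    the 1 x 1 case of the slackened inequality. In the converse, the additive term [sigma] turns
    inequalities into equalities: an embedded corner state misses part of [rho], and the missing
    part is itself an admissible [sigma]. Homogeneity is indispensable because the two-level piece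
    cut out of a larger state has trace less than one; only after rescaling does its weight become a
    function of [p_i / p_j] divided by [p_j]. The diagonal units [E_ii] live on a single level,
    invisible to the two-level kernel; a rotation at a multiple of the identity ties their weight to
    the same function at 1. The matrix theory is done over an arbitrary [numClosedFieldType], so the
    Archimedean property, which squeezing an additive function between rationals requires, appears
    as the hypothesis [arch]. *)

Section HermitianForms.
Context {C : numClosedFieldType}.

Lemma mxDE m n (A B : 'M[C]_(m, n)) i j : (A + B) i j = A i j + B i j.
Proof. by rewrite mxE. Qed.

Lemma mxZE m n a (A : 'M[C]_(m, n)) i j : (a *: A) i j = a * A i j.
Proof. by rewrite mxE. Qed.

Lemma adjmxM m n p (A : 'M[C]_(m, n)) (B : 'M[C]_(n, p)) :
  (A *m B)^t* = B^t* *m A^t*.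
Proof. by rewrite trmx_mul map_mxM. Qed.

Lemma adjmxD m n (A B : 'M[C]_(m, n)) : (A + B)^t* = A^t* + B^t*.
Proof. by rewrite linearD map_mxD. Qed.

Lemma adjmxB m n (A B : 'M[C]_(m, n)) : (A - B)^t* = A^t* - B^t*.
Proof. by rewrite linearB map_mxB. Qed.

Lemma adjmxZ m n (a : C) (A : 'M[C]_(m, n)) : (a *: A)^t* = a^* *: A^t*.
Proof. by rewrite linearZ map_mxZ. Qed.

Lemma adjmx1 n : (1%:M : 'M[C]_n)^t* = 1%:M.
Proof. by rewrite trmx1 map_mx1. Qed.

Lemma adjmx0 m n : (0 : 'M[C]_(m, n))^t* = 0.
Proof. by rewrite trmx0 map_mx0. Qed.

Definition qform n (A : 'M[C]_n) (x : 'cV[C]_n) : C := (x^t* *m A *m x) 0 0.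

(* Over [R[i]] this is convertible to [psd] of Defs, and likewise for the other
   notions below that are generic copies of those of Defs. *)
Definition psdmx n (A : 'M[C]_n) : Prop := forall x, 0 <= qform A x.

Definition pdmx n (A : 'M[C]_n) : Prop := forall x, x != 0 -> 0 < qform A x.

Definition loewner n (A B : 'M[C]_n) : Prop := psdmx (B - A).

Definition sqnorm n (x : 'cV[C]_n) : C := qform 1%:M x.

Lemma qformD n (A B : 'M[C]_n) x : qform (A + B) x = qform A x + qform B x.
Proof. by rewrite /qform mulmxDr mulmxDl mxE. Qed.

Lemma qformB n (A B : 'M[C]_n) x : qform (A - B) x = qform A x - qform B x.
Proof. by rewrite /qform mulmxBr mulmxBl !mxE. Qed.

Lemma qformZ n a (A : 'M[C]_n) x : qform (a *: A) x = a * qform A x.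
Proof. by rewrite /qform -scalemxAr -scalemxAl mxE. Qed.

Lemma qform_sum n (I : finType) (A : I -> 'M[C]_n) x :
  qform (\sum_i A i) x = \sum_i qform (A i) x.
Proof. by rewrite /qform mulmx_sumr mulmx_suml summxE. Qed.

Lemma qform_congr m n (S : 'M[C]_(m, n)) (A : 'M[C]_m) x :
  qform (S^t* *m A *m S) x = qform A (S *m x).
Proof. by rewrite /qform adjmxM !mulmxA. Qed.

Lemma qform_gram m n (S : 'M[C]_(m, n)) x :
  qform (S^t* *m S) x = sqnorm (S *m x).
Proof. by rewrite /sqnorm -qform_congr mulmx1. Qed.

Lemma sqnormE n (x : 'cV[C]_n) : sqnorm x = \sum_i `|x i 0| ^+ 2.
Proof.
rewrite /sqnorm /qform mulmx1 mxE; apply: eq_bigr => i _.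
by rewrite !mxE mulrC -normCK.
Qed.

Lemma sqnorm_ge0 n (x : 'cV[C]_n) : 0 <= sqnorm x.
Proof. by rewrite sqnormE sumr_ge0 // => i _; rewrite exprn_ge0. Qed.

Lemma qform0r n (A : 'M[C]_n) : qform A 0 = 0.
Proof. by rewrite /qform mulmx0 mxE. Qed.

Lemma pd_psd n (A : 'M[C]_n) : pdmx A -> psdmx A.
Proof.
move=> pA x; have [->|x0] := eqVneq x 0; first by rewrite qform0r.
exact/ltW/pA.
Qed.

Lemma psd_congr m n (S : 'M[C]_(m, n)) (A : 'M[C]_m) :
  psdmx A -> psdmx (S^t* *m A *m S).
Proof. by move=> pA x; rewrite qform_congr; apply: pA. Qed.

Lemma psd_gram m n (S : 'M[C]_(m, n)) : psdmx (S^t* *m S).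
Proof. by move=> x; rewrite qform_gram sqnorm_ge0. Qed.

Lemma psdD n (A B : 'M[C]_n) : psdmx A -> psdmx B -> psdmx (A + B).
Proof.
by move=> pA pB x; rewrite qformD addr_ge0.
Qed.

Lemma loewnerP n (A B : 'M[C]_n) :
  loewner A B <-> forall x, qform A x <= qform B x.
Proof.
split=> AB x; last by rewrite qformB subr_ge0.
by rewrite -subr_ge0 -qformB; apply: AB.
Qed.

Lemma qform_delta n (A : 'M[C]_n) i : qform A (delta_mx i 0) = A i i.
Proof.
by rewrite /qform trmx_delta map_delta_mx -rowE -[row i A *m _]colE !mxE.
Qed.

(* Polarization along [e_i + e_j] and [e_i + 'i e_j]. *)
Lemma qform_eq0 n (A : 'M[C]_n) : (forall x, qform A x = 0) -> A = 0.
Proof.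
move=> A0.
have form (x y : 'cV[C]_n) : (x^t* *m A *m y) 0 0 + (y^t* *m A *m x) 0 0 = 0.
  have := A0 (x + y); rewrite /qform adjmxD mulmxDl mulmxDl.
  rewrite mulmxDr mulmxDr !mxDE.
  have := A0 x; rewrite /qform => ->; have := A0 y; rewrite /qform => ->.
  by rewrite add0r addr0.
apply/matrixP => i j; rewrite [RHS]mxE.
have E (k l : 'I_n) :
    ((delta_mx k 0 : 'cV[C]_n)^t* *m A *m (delta_mx l 0 : 'cV[C]_n)) 0 0 = A k l.
  by rewrite trmx_delta map_delta_mx -rowE -[row k A *m _]colE !mxE.
have h1 := form (delta_mx i 0) (delta_mx j 0); rewrite !E in h1.
have h2 := form (delta_mx i 0) ('i *: delta_mx j 0).
rewrite adjmxZ conjCi -2!scalemxAl -scalemxAr !mxZE !E mulNr in h2.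
have /eqP : 'i * (A i j - A j i) = 0 by rewrite mulrBr -h2.
rewrite mulf_eq0 (negPf (neq0Ci _)) /= subr_eq0 => /eqP ij.
by move: h1; rewrite -ij -mulr2n => /eqP; rewrite mulrn_eq0 /= => /eqP.
Qed.

Lemma qform_adj n (A : 'M[C]_n) x : qform (A^t*) x = (qform A x)^*.
Proof.
rewrite /qform.
have -> : x^t* *m A^t* *m x = (x^t* *m A *m x)^t*.
  by rewrite !adjmxM trmxCK mulmxA.
by rewrite !mxE.
Qed.

Lemma psd_hermitian n (A : 'M[C]_n) : psdmx A -> A^t* = A.
Proof.
move=> pA; apply/eqP; rewrite -subr_eq0; apply/eqP/qform_eq0 => x.
rewrite qformB qform_adj; apply/eqP; rewrite subr_eq0; apply/eqP.
by apply/CrealP/ger0_real/pA.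
Qed.

Definition rdiag n (p : 'I_n -> C) : 'M[C]_n :=
  diag_mx (\row_i p i).

Lemma qform_rdiag n (p : 'I_n -> C) x :
  qform (rdiag p) x = \sum_i p i * `|x i 0| ^+ 2.
Proof.
rewrite /qform mul_mx_diag mxE; apply: eq_bigr => i _.
by rewrite !mxE mulrAC mulrC [_^* * _]mulrC -normCK.
Qed.

Lemma rdiag_adj n (p : 'I_n -> C) : (forall i, p i \is Num.real) ->
  (rdiag p)^t* = rdiag p.
Proof.
move=> pr; apply/matrixP => i j; rewrite !mxE eq_sym; case: eqVneq => [->|_].
  by rewrite mulr1n conj_Creal.
by rewrite mulr0n rmorph0.
Qed.

Lemma rdiagM n (p q : 'I_n -> C) :
  rdiag p *m rdiag q = rdiag (fun i => p i * q i).
Proof.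
by rewrite mulmx_diag; congr diag_mx; apply/rowP => i; rewrite !mxE.
Qed.

Lemma rdiag1 n (p : 'I_n -> C) : (forall i, p i = 1) -> rdiag p = 1%:M.
Proof.
by move=> p1; rewrite -diag_const_mx; congr diag_mx; apply/rowP => i; rewrite !mxE p1.
Qed.

Lemma rdiagZ n (c : C) (p : 'I_n -> C) :
  c *: rdiag p = rdiag (fun i => c * p i).
Proof.
by rewrite -linearZ; congr diag_mx; apply/rowP => i; rewrite !mxE.
Qed.

Lemma rdiagV n (p : 'I_n -> C) : (forall i, p i != 0) ->
  rdiag p *m rdiag (fun i => (p i)^-1) = 1%:M.
Proof. by move=> p0; rewrite rdiagM rdiag1 // => i; rewrite divff. Qed.

Lemma pd_rdiag n (p : 'I_n -> C) : (forall i, 0 < p i) -> pdmx (rdiag p).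
Proof.
move=> p0 x x0; rewrite qform_rdiag.
rewrite lt0r sumr_ge0 ?andbT; last first.
  by move=> i _; rewrite mulr_ge0 ?exprn_ge0 // ltW.
apply: contra x0 => /eqP s0; apply/eqP/colP => i; rewrite mxE; apply/eqP.
have h j : true -> 0 <= p j * `|x j 0| ^+ 2.
  by rewrite mulr_ge0 ?exprn_ge0 // ltW.
move: (psumr_eq0P h s0 (isT : xpredT i)) => /eqP.
rewrite mulf_eq0 expf_eq0 /= normr_eq0 => /orP[|//].
by rewrite gt_eqF.
Qed.

Lemma pd_rdiag_gt0 n (p : 'I_n -> C) : pdmx (rdiag p) -> forall i, 0 < p i.
Proof.
move=> pp i; have := pp (delta_mx i 0).
rewrite qform_delta !mxE eqxx mulr1n; apply.
by apply/eqP => /matrixP/(_ i 0)/eqP; rewrite !mxE !eqxx oner_eq0.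
Qed.

Definition unitary n (U : 'M[C]_n) := U^t* *m U = 1%:M.

Lemma unitaryC n (U : 'M[C]_n) : unitary U -> U *m U^t* = 1%:M.
Proof. exact: mulmx1C. Qed.

Lemma unitary_adj n (U : 'M[C]_n) : unitary U -> unitary (U^t*).
Proof. by move=> uU; rewrite /unitary trmxCK unitaryC. Qed.

Lemma pd_congr_inj m n (S : 'M[C]_(m, n)) S' (A : 'M[C]_m) :
  S' *m S = 1%:M -> pdmx A -> pdmx (S^t* *m A *m S).
Proof.
move=> SS pA x x0; rewrite qform_congr; apply: pA.
by apply: contra x0 => /eqP h; rewrite -[x]mul1mx -SS -mulmxA h mulmx0.
Qed.

Lemma pd_unitary n (U : 'M[C]_n) (A : 'M[C]_n) :
  unitary U -> pdmx A -> pdmx (U^t* *m A *m U).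
Proof. by move=> uU; apply: pd_congr_inj uU. Qed.

Lemma spectral_decomposition n (A : 'M[C]_n) : A^t* = A ->
  exists U : 'M[C]_n, exists p : 'I_n -> C,
    [/\ unitary U, forall i, p i \is Num.real & A = U^t* *m rdiag p *m U].
Proof.
move=> hA.
have hsA : A \is hermsymmx by apply/is_hermitianmxP; rewrite expr0 scale1r hA.
have nA : A \is normalmx by apply: hermitian_normalmx.
have /unitarymxP uP := spectral_unitarymx A.
exists (spectralmx A), (fun i => spectral_diag A 0 i); split.
- exact: mulmx1C.
- by move=> i; have /mxOverP/(_ 0 i) := hermitian_spectral_diag_real hsA.
have /orthomx_spectralP {1}-> := nA.
rewrite (invmx_unitary (spectral_unitarymx A)) /rdiag.
by have <- : spectral_diag A = \row_i spectral_diag A 0 i by apply/rowP => i; rewrite mxE.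
Qed.

Lemma unitary_conjK n (U : 'M[C]_n) A :
  unitary U -> U *m (U^t* *m A *m U) *m U^t* = A.
Proof.
move=> uU; rewrite !mulmxA unitaryC // mul1mx -mulmxA unitaryC // mulmx1 //.
Qed.

Lemma pd_spectral n (A : 'M[C]_n) : pdmx A ->
  exists U : 'M[C]_n, exists p : 'I_n -> C,
    [/\ unitary U, forall i, 0 < p i & A = U^t* *m rdiag p *m U].
Proof.
move=> pA; have [U [p [uU _ defA]]] := spectral_decomposition (psd_hermitian (pd_psd pA)).
exists U, p; split=> //; apply: pd_rdiag_gt0.
rewrite -(unitary_conjK (rdiag p) uU) -defA -{1}[U]trmxCK.
exact: pd_unitary (unitary_adj uU) pA.
Qed.

Lemma psd_spectral n (A : 'M[C]_n) : psdmx A ->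
  exists U : 'M[C]_n, exists p : 'I_n -> C,
    [/\ unitary U, forall i, 0 <= p i & A = U^t* *m rdiag p *m U].
Proof.
move=> pA; have [U [p [uU _ defA]]] := spectral_decomposition (psd_hermitian pA).
exists U, p; split=> // i.
have := psd_congr (U^t*) pA; rewrite trmxCK defA unitary_conjK // => /(_ (delta_mx i 0)).
by rewrite qform_delta !mxE eqxx mulr1n.
Qed.

Lemma psd_factor n (A : 'M[C]_n) : psdmx A -> exists D : 'M[C]_n, D^t* *m D = A.
Proof.
move=> pA; have [U [p [uU p0 ->]]] := psd_spectral pA.
exists (rdiag (fun i => sqrtC (p i)) *m U).
rewrite adjmxM rdiag_adj; last by move=> i; rewrite ger0_real ?sqrtC_ge0.
rewrite mulmxA -[U^t* *m _ *m _]mulmxA rdiagM.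
congr (_ *m _ *m _); congr diag_mx; apply/rowP => i; rewrite !mxE.
by rewrite -expr2 sqrtCK.
Qed.

End HermitianForms.

(** * Functional calculus and the inequality of Hansen *)

Section FunctionalCalculus.
Context {C : numClosedFieldType}.
Implicit Types g : C -> C.

Definition fcalc g n (A : 'M[C]_n) : 'M[C]_n :=
  invmx (spectralmx A) *m diag_mx (map_mx g (spectral_diag A)) *m spectralmx A.

Definition opmonotone g : Prop :=
  (forall x, 0 < x -> 0 < g x) /\
  (forall n (A B : 'M[C]_n), (0 < n)%N -> pdmx A -> loewner A B ->
     pdmx (fcalc g A) /\ loewner (fcalc g A) (fcalc g B)).

(** Entrywise the hypothesis reads [d_i Z_ij = Z_ij e_j], so [d_i = e_j] wherever [Z_ij] is nonzero,
    and an arbitrary [g] passes through. *)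
Lemma diag_intertwine g m n (d : 'rV[C]_m) (e : 'rV[C]_n) Z :
  diag_mx d *m Z = Z *m diag_mx e ->
  diag_mx (map_mx g d) *m Z = Z *m diag_mx (map_mx g e).
Proof.
rewrite !mul_diag_mx !mul_mx_diag => /matrixP dZ; apply/matrixP => i j.
have := dZ i j; rewrite !mxE; have [->|Z0] := eqVneq (Z i j) 0.
  by rewrite !mulr0 !mul0r.
by rewrite mulrC => /(mulfI Z0) ->; rewrite mulrC.
Qed.

Lemma hermitian_normal n (A : 'M[C]_n) : A^t* = A -> A \is normalmx.
Proof. by move=> hA; apply/normalmxP; rewrite hA. Qed.

Lemma fcalc_intertwine g m n (A : 'M[C]_m) (B : 'M[C]_n) W :
  A^t* = A -> B^t* = B -> A *m W = W *m B -> fcalc g A *m W = W *m fcalc g B.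
Proof.
move=> /hermitian_normal/orthomx_spectralP dA /hermitian_normal/orthomx_spectralP dB AW.
have uP := spectral_unit A; have uQ := spectral_unit B.
rewrite /fcalc; set P := spectralmx A in dA uP *; set Q := spectralmx B in dB uQ *.
set d := spectral_diag A in dA *; set e := spectral_diag B in dB *.
have /(diag_intertwine g) : diag_mx d *m (P *m W *m invmx Q) =
    (P *m W *m invmx Q) *m diag_mx e.
  have -> : diag_mx d *m (P *m W *m invmx Q) = P *m (A *m W) *m invmx Q.
    by rewrite dA !mulmxA mulmxV // mul1mx.
  by rewrite AW dB !mulmxA mulmxK.
rewrite !mulmxA => /(congr1 (fun X => invmx P *m X *m Q)).
by rewrite !mulmxA mulmxKV // mulVmx // mul1mx.
Qed.

Lemma rdiag_herm n (U : 'M[C]_n) (p : 'I_n -> C) : (forall i, p i \is Num.real) ->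
  (U^t* *m rdiag p *m U)^t* = U^t* *m rdiag p *m U.
Proof. by move=> pr; rewrite !adjmxM trmxCK rdiag_adj // mulmxA. Qed.

(** [fcalc] is tied to the eigenbasis [P] picked by [spectralmx]. Any other eigenbasis gives the
    same operator, because the change of basis [P *m U^t*] intertwines the two diagonal matrices. *)
Lemma fcalc_rdiag g n (U : 'M[C]_n) (p : 'I_n -> C) :
  unitary U -> (forall i, p i \is Num.real) ->
  fcalc g (U^t* *m rdiag p *m U) = U^t* *m rdiag (fun i => g (p i)) *m U.
Proof.
move=> uU pr; have hA := rdiag_herm U pr; move: hA.
set A := U^t* *m _ *m U => hA.
have /orthomx_spectralP dA := hermitian_normal hA.
have uP := spectral_unit A; rewrite /fcalc.
set P := spectralmx A in dA uP *; set d := spectral_diag A in dA *.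
have /(diag_intertwine g) : diag_mx d *m (P *m U^t*) = P *m U^t* *m rdiag p.
  have -> : diag_mx d *m (P *m U^t*) = P *m A *m U^t*.
    by move: dA; set Q := invmx P; move=> ->; rewrite !mulmxA mulmxV // mul1mx.
  by rewrite /A -!mulmxA unitaryC // mulmx1.
have -> : map_mx g (\row_i p i) = \row_i g (p i) by apply/rowP => i; rewrite !mxE.
rewrite !mulmxA => /(congr1 (fun X => invmx P *m X *m U)).
by rewrite -!mulmxA uU mulmx1 !mulmxA mulVmx // mul1mx.
Qed.

Lemma unitary1 n : unitary (1%:M : 'M[C]_n).
Proof. by rewrite /unitary adjmx1 mulmx1. Qed.

Lemma fcalc_rdiag1 g n (p : 'I_n -> C) : (forall i, p i \is Num.real) ->
  fcalc g (rdiag p) = rdiag (fun i => g (p i)).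
Proof.
move=> pr; have := fcalc_rdiag g (unitary1 n) pr.
by rewrite adjmx1 !mul1mx !mulmx1.
Qed.

Lemma pd_fcalc g n (A : 'M[C]_n) :
  (forall x, 0 < x -> 0 < g x) -> pdmx A -> pdmx (fcalc g A).
Proof.
move=> g0 /pd_spectral[U [p [uU p0 ->]]].
rewrite fcalc_rdiag //; last by move=> i; rewrite gtr0_real.
by apply: pd_unitary => //; apply: pd_rdiag => i; apply: g0.
Qed.

Lemma pd_hermitian n (A : 'M[C]_n) : pdmx A -> A^t* = A.
Proof. by move/pd_psd/psd_hermitian. Qed.

Lemma qform_block m n (A : 'M[C]_m) (B : 'M[C]_n) x y :
  qform (block_mx A 0 0 B) (col_mx x y) = qform A x + qform B y.
Proof.
rewrite /qform tr_col_mx map_row_mx mul_row_block mul_row_col.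
by rewrite !mulmx0 addr0 add0r mxDE.
Qed.

Lemma pd_block m n (A : 'M[C]_m) (B : 'M[C]_n) : pdmx A -> pdmx B ->
  pdmx (block_mx A 0 0 B).
Proof.
move=> pA pB x; rewrite -[x]vsubmxK qform_block.
have [->|x0 _] := eqVneq (usubmx x) 0; last first.
  by rewrite ltr_wpDr //; [apply: (pd_psd pB)|apply: pA].
have [->|y0 _] := eqVneq (dsubmx x) 0; first by rewrite col_mx0 eqxx.
by rewrite qform0r add0r pB.
Qed.

(** Each coordinate inclusion intertwines the block matrix with one of its blocks, so
    [fcalc_intertwine] yields the two block columns of the result. *)
Lemma fcalc_block g m n (A : 'M[C]_m) (B : 'M[C]_n) : A^t* = A -> B^t* = B ->
  fcalc g (block_mx A 0 0 B) = block_mx (fcalc g A) 0 0 (fcalc g B).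
Proof.
move=> hA hB; set M := block_mx A 0 0 B.
have hM : M^t* = M by rewrite tr_block_mx map_block_mx hA hB !adjmx0.
have M1 : M *m col_mx 1%:M 0 = col_mx 1%:M 0 *m A.
  by rewrite mul_block_col mul_col_mx !mulmx1 !mul1mx !mulmx0 !mul0mx !addr0.
have M2 : M *m col_mx 0 1%:M = col_mx 0 1%:M *m B.
  by rewrite mul_block_col mul_col_mx !mulmx1 !mul1mx !mulmx0 !mul0mx !add0r.
have F1 := fcalc_intertwine g hM hA M1; have F2 := fcalc_intertwine g hM hB M2.
rewrite -[LHS]mulmx1 (scalar_mx_block m n 1) !block_mxEh mul_mx_row F1 F2.
by rewrite !mul_col_mx !mul1mx !mul0mx.
Qed.

Lemma sqnorm_unitary n (U : 'M[C]_n) x : unitary U -> sqnorm (U *m x) = sqnorm x.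
Proof. by move=> uU; rewrite -qform_gram uU. Qed.

Lemma pd_ge n (A : 'M[C]_n) : pdmx A ->
  exists2 b : C, 0 < b & forall x, b * sqnorm x <= qform A x.
Proof.
move=> /pd_spectral[U [p [uU p0 ->]]].
have s0 : 0 <= \sum_i (p i)^-1 by apply: sumr_ge0 => i _; rewrite invr_ge0 ltW.
have s1 : 0 < 1 + \sum_i (p i)^-1 by rewrite ltr_pwDl.
(* A lower bound for every eigenvalue, written without a minimum; the summand 1 keeps it positive
   even for an empty sum. *)
exists (1 + \sum_i (p i)^-1)^-1; first by rewrite invr_gt0.
move=> x; rewrite qform_congr qform_rdiag -(sqnorm_unitary x uU) sqnormE mulr_sumr.
apply: ler_sum => i _; rewrite ler_wpM2r ?exprn_ge0 //.
rewrite -[p i]invrK lef_pV2 ?posrE ?invr_gt0 //.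
rewrite (bigD1 i) //= addrCA lerDl addr_ge0 //.
by apply: sumr_ge0 => j _; rewrite invr_ge0 ltW.
Qed.

Lemma psd_le n (A : 'M[C]_n) : psdmx A ->
  exists2 b : C, 0 < b & forall x, qform A x <= b * sqnorm x.
Proof.
move=> /psd_spectral[U [p [uU p0 ->]]].
exists (1 + \sum_i p i); first by rewrite ltr_pwDl // sumr_ge0.
move=> x; rewrite qform_congr qform_rdiag -(sqnorm_unitary x uU) sqnormE mulr_sumr.
apply: ler_sum => i _; rewrite ler_wpM2r ?exprn_ge0 //.
rewrite (bigD1 i) //= addrCA lerDl addr_ge0 //.
by apply: sumr_ge0.
Qed.

Lemma qformDr n (A : 'M[C]_n) x y : qform A (x + y) =
  qform A x + qform A y + ((x^t* *m A *m y) 0 0 + (y^t* *m A *m x) 0 0).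
Proof.
rewrite /qform adjmxD mulmxDl mulmxDl mulmxDr mulmxDr !mxDE.
ring.
Qed.

Lemma qformZr n (A : 'M[C]_n) a x : qform A (a *: x) = `|a| ^+ 2 * qform A x.
Proof.
by rewrite /qform adjmxZ -2!scalemxAl -scalemxAr !mxZE mulrA normCK [a * _]mulrC.
Qed.

(* From [0 <= qform A (x - r^-1 y)]. *)
Lemma qformDr_le n (A : 'M[C]_n) (r : C) (x y : 'cV[C]_n) : psdmx A -> 0 < r ->
  qform A (x + y) <= (1 + r) * qform A x + (1 + r^-1) * qform A y.
Proof.
move=> pA r0; have := pA (x - r^-1 *: y).
have r1 : 0 <= r^-1 by rewrite invr_ge0 ltW.
rewrite -scaleNr !qformDr qformZr normrN (ger0_norm r1).
rewrite adjmxZ -2!scalemxAl -scalemxAr !mxZE.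
have -> : (- r^-1)^* = - r^-1 by rewrite conj_Creal // rpredN ger0_real.
rewrite -mulrDr.
set s := (x^t* *m A *m y) 0 0 + _ => h.
rewrite -subr_ge0.
have -> : (1 + r) * qform A x + (1 + r^-1) * qform A y - (qform A x + qform A y + s)
   = r * (qform A x + r^-1 ^+ 2 * qform A y + - r^-1 * s).
  by field; rewrite gt_eqF.
by rewrite mulr_ge0 // ltW.
Qed.

Lemma le_of_le_scale (a b : C) : 0 <= b -> (forall k, 1 < k -> a <= k * b) -> a <= b.
Proof.
move=> b0 h.
(* The factor 2 already forces [a] to be real, hence comparable with [b]. *)
have h2 : a <= 2%:R * b by apply: h; rewrite ltr1n.
have ar : a \is Num.real.
  by rewrite (ler_real h2) ger0_real // mulr_ge0.
have [//|ba] := real_leP ar (ger0_real b0).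
move: b0; rewrite le_eqVlt => /orP[/eqP b0|b0].
  by move: (lt_le_trans ba h2); rewrite -b0 mulr0 ltxx.
have ab : 1 < a / b by rewrite ltr_pdivlMr // mul1r.
(* If [b < a], the midpoint of 1 and [a / b] is an admissible factor with [k * b = (a + b) / 2 < a],
   a contradiction. *)
have k1 : 1 < (1 + a / b) / 2%:R by rewrite ltr_pdivlMr ?ltr0n // mul1r mulr2n ltrD2l.
have := h _ k1.
have -> : (1 + a / b) / 2%:R * b = (b + a) / 2%:R by field; rewrite gt_eqF.
by rewrite ler_pdivlMr ?ltr0n // mulr_natr mulr2n lerD2r => /(lt_le_trans ba); rewrite ltxx.
Qed.

Lemma scalar_rdiag n (a : C) : a%:M = rdiag (fun _ : 'I_n => a).
Proof.
by rewrite /rdiag -diag_const_mx; congr diag_mx; apply/rowP => i; rewrite !mxE.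
Qed.

Lemma pd_scalar n (a : C) : 0 < a -> pdmx (a%:M : 'M[C]_n).
Proof. by move=> a0; rewrite scalar_rdiag; apply: pd_rdiag. Qed.

Lemma qform_scalar n (a : C) (x : 'cV[C]_n) : qform a%:M x = a * sqnorm x.
Proof. by rewrite -scalemx1 qformZ. Qed.

Lemma pdZ n (A : 'M[C]_n) a : 0 < a -> pdmx A -> pdmx (a *: A).
Proof. by move=> a0 pA x x0; rewrite qformZ mulr_gt0 // pA. Qed.

Lemma sqrtC_gt1 (k : C) : 1 < k -> 1 < sqrtC k.
Proof.
move=> k1; have k0 : 0 <= k by rewrite ltW // (lt_trans ltr01).
rewrite real_ltNge ?ger0_real ?ler01 ?sqrtC_ge0 //; apply/negP => r1.
have := exprn_ile1 2 _ r1; rewrite sqrtC_ge0 sqrtCK => /(_ k0) /(lt_le_trans k1).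
by rewrite ltxx.
Qed.

Lemma fcalcW_isometry g m n (M : 'M[C]_m) (B : 'M[C]_n) W :
  M^t* = M -> B^t* = B -> W^t* *m W = 1%:M -> M *m W = W *m B ->
  W^t* *m fcalc g M *m W = fcalc g B.
Proof.
by move=> hM hB WW MW; rewrite -mulmxA (fcalc_intertwine _ hM hB MW) mulmxA WW mul1mx.
Qed.

(* Dilate [V] to the isometry [W = col_mx V D] and put [At = diag(A, e)].  For
   [c] large, [At <= M] with [M = W (k B) W^* + c (1 - W W^* )], and since
   [M W = W (k B)] the compression of [g(M)] by [W] is [g(k B)]. *)
Lemma hansen_scale g m n (A : 'M[C]_m) (B : 'M[C]_n) (V : 'M[C]_(m, n)) k :
  opmonotone g -> (0 < n)%N -> 1 < k -> pdmx A -> pdmx B ->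
  loewner (V^t* *m V) 1%:M -> loewner (V^t* *m A *m V) B ->
  loewner (V^t* *m fcalc g A *m V) (fcalc g (k *: B)).
Proof.
move=> [g0 gm] n0 k1 pA pB VV VAV.
have k0 : 0 < k := lt_trans ltr01 k1.
have [b b0 Bb] := pd_ge pB.
(* The slack [k] is spent as [r * r]. One factor pays for separating [W u] from the rest in
   [qformDr_le] with parameter [r - 1]; the other absorbs the corner [e = b (r - 1)], which is at
   most [(r - 1) B] in quadratic form. *)
have r1 := sqrtC_gt1 k1; have rr := sqrtCK k.
set r := sqrtC k in r1 rr.
have r0 : 0 < r := lt_trans ltr01 r1.
have r10 : 0 < r - 1 by rewrite subr_gt0.
set e := b * (r - 1); have e0 : 0 < e by rewrite mulr_gt0.
have [D DD] := psd_factor VV.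
set W := col_mx V D.
have WW : W^t* *m W = 1%:M.
  by rewrite tr_col_mx map_row_mx mul_row_col DD addrC subrK.
pose At : 'M[C]_(m + n) := block_mx A 0 0 e%:M.
have pAt : pdmx At by apply: pd_block => //; apply: pd_scalar.
have [a a0 Aa] := psd_le (pd_psd pAt).
set c := (1 + (r - 1)^-1) * a.
set Q := 1%:M - W *m W^t*.
have QQ : Q^t* *m Q = Q.
  rewrite adjmxB adjmx1 adjmxM trmxCK -/Q /Q mulmxBr mulmx1 mulmxBl mul1mx.
  by rewrite -mulmxA [W^t* *m _]mulmxA WW mul1mx subrr subr0.
set M := (W^t*)^t* *m (k *: B) *m W^t* + c *: (Q^t* *m Q).
have qM z : qform M z = k * qform B (W^t* *m z) + c * sqnorm (z - W *m (W^t* *m z)).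
  rewrite qformD qform_congr !qformZ qform_gram.
  by rewrite {1}/Q mulmxBl mul1mx mulmxA.
have AM : loewner At M.
  apply/loewnerP => z; rewrite qM; set u := W^t* *m z; set q := z - W *m u.
  have -> : qform At z = qform At (W *m u + q) by rewrite addrC subrK.
  apply: le_trans (qformDr_le (W *m u) q (pd_psd pAt) r10) _.
  have -> : 1 + (r - 1) = r by rewrite addrC subrK.
  apply: lerD; last first.
    by rewrite /c -mulrA ler_pM2l // ltr_pwDl ?invr_ge0 // ltW.
  rewrite -rr expr2 -mulrA ler_pM2l // mul_col_mx qform_block qform_scalar.
  move/loewnerP/(_ u): VAV; rewrite qform_congr => hV.
  have hD : sqnorm (D *m u) <= sqnorm u.
    by rewrite -qform_gram DD qformB qform_gram lerBlDr lerDl sqnorm_ge0.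
  have hB : e * sqnorm (D *m u) <= (r - 1) * qform B u.
    rewrite /e [b * _]mulrC -mulrA ler_pM2l //.
    by apply: le_trans (Bb u); rewrite ler_pM2l.
  apply: le_trans (lerD hV hB) _.
  by rewrite le_eqVlt; apply/orP; left; apply/eqP; ring.
have hM : M^t* = M.
  apply: psd_hermitian => z; apply: le_trans (pd_psd pAt z) _.
  by move: z; apply/loewnerP.
have hB : (k *: B)^t* = k *: B := pd_hermitian (pdZ k0 pB).
have MW : M *m W = W *m (k *: B).
  rewrite /M trmxCK QQ mulmxDl -[_ *m W]mulmxA WW mulmx1 -scalemxAl.
  by rewrite mulmxBl mul1mx -[W *m _ *m W]mulmxA WW mulmx1 subrr scaler0 addr0.
have mn0 : (0 < m + n)%N by rewrite addn_gt0 n0 orbT.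
have [_ /loewnerP h] := gm _ At M mn0 pAt AM.
apply/loewnerP => x; have := h (W *m x).
rewrite -[X in _ <= X]qform_congr (fcalcW_isometry g hM hB WW MW).
rewrite fcalc_block ?pd_hermitian //; last exact: pd_scalar.
rewrite mul_col_mx qform_block qform_congr; apply: le_trans.
by rewrite lerDl; apply/pd_psd/pd_fcalc/pd_scalar.
Qed.

Lemma fcalc_scalar g n (a : C) : a \is Num.real ->
  fcalc g (a%:M : 'M[C]_n) = (g a)%:M.
Proof. by move=> ar; rewrite !scalar_rdiag fcalc_rdiag1. Qed.

Lemma loewner_scalar (a b : C) :
  loewner (a%:M : 'M[C]_1) b%:M <-> a <= b.
Proof.
split=> [/loewnerP/(_ (delta_mx 0 0))|ab].
  by rewrite !qform_delta !mxE eqxx !mulr1n.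
by apply/loewnerP => x; rewrite !qform_scalar ler_wpM2r ?sqnorm_ge0.
Qed.

(** The scalar case of [hansen_scale]: with [V = s], [s^2 = 1 / (k' k)], [A = k x] and [B = x / k'],
    it gives [g (k x) <= k' k g x], and [k' > 1] is arbitrary. *)
Lemma opmonotone_scale g (k x : C) : opmonotone g -> 1 < k -> 0 < x ->
  g (k * x) <= k * g x.
Proof.
move=> og k1 x0; have [g0 _] := og; have k0 : 0 < k := lt_trans ltr01 k1.
apply: le_of_le_scale => [|k' k1']; first by rewrite mulr_ge0 // ltW // g0.
have k0' : 0 < k' := lt_trans ltr01 k1'.
have kk0 : 0 < k' * k by rewrite mulr_gt0.
set s := sqrtC (k' * k)^-1.
have s2 : s * s = (k' * k)^-1 by rewrite -expr2 sqrtCK.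
have sr : s^* = s by rewrite conj_Creal // ger0_real // sqrtC_ge0 invr_ge0 ltW.
have y0 : 0 < (k' * k)^-1 * (k * x) by rewrite !mulr_gt0 // invr_gt0.
have sadj : (s%:M : 'M[C]_1)^t* = s%:M by rewrite tr_scalar_mx map_scalar_mx /= sr.
have := @hansen_scale g 1 1 (k * x)%:M ((k' * k)^-1 * (k * x))%:M s%:M k' og
  isT k1' (pd_scalar (mulr_gt0 k0 x0)) (pd_scalar y0).
rewrite sadj scale_scalar_mx !fcalc_scalar ?gtr0_real ?mulr_gt0 ?invr_gt0 //.
rewrite -!scalar_mxM s2 !loewner_scalar.
have -> : s * (k * x) * s = (k' * k)^-1 * (k * x) by rewrite mulrAC s2.
have -> : s * g (k * x) * s = (k' * k)^-1 * g (k * x) by rewrite mulrAC s2.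
have -> : k' * ((k' * k)^-1 * (k * x)) = x by field; rewrite !gt_eqF.
move=> h; rewrite mulrA -(ler_pdivrMl _ _ kk0); apply: h => //.
rewrite invf_le1 // -[1]mulr1; apply: ler_pM => //; exact: ltW.
Qed.

Lemma fcalc_scale g n (B : 'M[C]_n) k : opmonotone g -> 1 < k -> pdmx B ->
  loewner (fcalc g (k *: B)) (k *: fcalc g B).
Proof.
move=> og k1 /pd_spectral[U [p [uU p0 ->]]].
have k0 : 0 < k := lt_trans ltr01 k1.
have pr i : p i \is Num.real by rewrite gtr0_real.
have kpr i : k * p i \is Num.real by rewrite gtr0_real // mulr_gt0.
rewrite scalemxAl scalemxAr rdiagZ !fcalc_rdiag //.
apply/loewnerP => x; rewrite qformZ !qform_congr !qform_rdiag mulr_sumr.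
apply: ler_sum => i _; rewrite mulrA ler_wpM2r ?exprn_ge0 //.
exact: opmonotone_scale.
Qed.

(** Since [g (k B) <= k g(B)], the slack in [hansen_scale] becomes a factor outside the quadratic
    form, where [le_of_le_scale] removes it. *)
Lemma hansen g m n (A : 'M[C]_m) (B : 'M[C]_n) (V : 'M[C]_(m, n)) :
  opmonotone g -> (0 < n)%N -> pdmx A -> pdmx B ->
  loewner (V^t* *m V) 1%:M -> loewner (V^t* *m A *m V) B ->
  loewner (V^t* *m fcalc g A *m V) (fcalc g B).
Proof.
move=> og n0 pA pB VV VAV; apply/loewnerP => x.
apply: le_of_le_scale => [|k k1]; first by apply/pd_psd/pd_fcalc; case: og.
have /loewnerP/(_ x) h := hansen_scale og n0 k1 pA pB VV VAV.
apply: le_trans h _; rewrite -qformZ; apply/loewnerP: x; exact: fcalc_scale.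
Qed.

Lemma rdiag_sqr n (r : 'I_n -> C) (p q : 'I_n -> C) :
  (forall i, p i = r i * q i * r i) -> rdiag r *m rdiag q *m rdiag r = rdiag p.
Proof.
move=> h; rewrite !rdiagM /rdiag; congr diag_mx.
by apply/rowP => i; rewrite !mxE h.
Qed.

(* Apply [hansen] to [V = r1^(1/2) S r2^(-1/2)]. *)
Lemma mean_transform g m n (l1 r1 : 'I_m -> C) (l2 r2 : 'I_n -> C)
    (S : 'M[C]_(m, n)) :
  opmonotone g -> (0 < n)%N ->
  (forall i, 0 < l1 i) -> (forall i, 0 < r1 i) ->
  (forall i, 0 < l2 i) -> (forall i, 0 < r2 i) ->
  loewner (S^t* *m rdiag l1 *m S) (rdiag l2) ->
  loewner (S^t* *m rdiag r1 *m S) (rdiag r2) ->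
  loewner (S^t* *m rdiag (fun i => r1 i * g (l1 i / r1 i)) *m S)
             (rdiag (fun i => r2 i * g (l2 i / r2 i))).
Proof.
move=> og n0 l10 r10 l20 r20 SL SR.
pose s1 i := sqrtC (r1 i); pose s2 i := (sqrtC (r2 i))^-1.
pose t2 i := sqrtC (r2 i).
have s1r i : s1 i \is Num.real by rewrite ger0_real // sqrtC_ge0 ltW.
have s2r i : s2 i \is Num.real by rewrite rpredV ger0_real // sqrtC_ge0 ltW.
have t2r i : t2 i \is Num.real by rewrite ger0_real // sqrtC_ge0 ltW.
have s1s i : s1 i * s1 i = r1 i by rewrite -expr2 sqrtCK.
have t2s i : t2 i * t2 i = r2 i by rewrite -expr2 sqrtCK.
have t2m i X : r2 i * X = t2 i * X * t2 i by rewrite mulrAC t2s.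
have t20 i : t2 i != 0 by rewrite sqrtC_eq0 gt_eqF.
have s2s i : s2 i * s2 i = (r2 i)^-1 by rewrite -(t2s i) invfM.
pose V := rdiag s1 *m S *m rdiag s2.
have Vadj : V^t* = rdiag s2 *m S^t* *m rdiag s1.
  by rewrite /V !adjmxM !rdiag_adj // mulmxA.
have congrV q p : (forall i, p i = s1 i * q i * s1 i) ->
    V^t* *m rdiag q *m V = rdiag s2 *m (S^t* *m rdiag p *m S) *m rdiag s2.
  move=> pq; rewrite Vadj /V -(rdiag_sqr pq) !mulmxA //.
have le2 (A B : 'M[C]_n) : loewner A B ->
    loewner (rdiag s2 *m A *m rdiag s2) (rdiag s2 *m B *m rdiag s2).
  move=> /(psd_congr (rdiag s2)); rewrite (rdiag_adj s2r) /loewner.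
  by rewrite mulmxBr mulmxBl.
have VV : loewner (V^t* *m V) 1%:M.
  have -> : V^t* *m V = V^t* *m rdiag (fun _ => 1) *m V
    by rewrite (rdiag1 (p := fun=> 1)) // mulmx1.
  rewrite (congrV _ r1) => [|i]; last by rewrite mulr1 s1s.
  have -> : 1%:M = rdiag s2 *m rdiag r2 *m rdiag s2.
    rewrite -(rdiag1 (p := fun _ : 'I_n => 1)) //; apply/esym/rdiag_sqr => i.
    by rewrite mulrAC s2s mulVf // gt_eqF.
  exact: le2.
have VLV : loewner (V^t* *m rdiag (fun i => l1 i / r1 i) *m V)
    (rdiag (fun i => l2 i / r2 i)).
  rewrite (congrV _ l1) => [|i]; last by rewrite mulrAC s1s mulrCA divff ?mulr1 // gt_eqF.
  have <- : rdiag s2 *m rdiag l2 *m rdiag s2 = rdiag (fun i => l2 i / r2 i).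
    by apply: rdiag_sqr => i; rewrite mulrAC s2s mulrC.
  exact: le2.
have d1 i : 0 < l1 i / r1 i by rewrite divr_gt0.
have d2 i : 0 < l2 i / r2 i by rewrite divr_gt0.
have := hansen og n0 (pd_rdiag d1) (pd_rdiag d2) VV VLV.
rewrite !fcalc_rdiag1; try by move=> i; rewrite gtr0_real.
rewrite (congrV _ (fun i => r1 i * g (l1 i / r1 i))); last first.
  by move=> i; rewrite mulrAC s1s.
move/(psd_congr (rdiag t2)); rewrite (rdiag_adj t2r) mulmxBr mulmxBl.
rewrite (rdiag_sqr (p := fun i => r2 i * g (l2 i / r2 i))
                   (q := fun i => g (l2 i / r2 i))); last first.
  by move=> i; apply: t2m.
have ts : rdiag t2 *m rdiag s2 = 1%:M by exact: rdiagV.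
have st : rdiag s2 *m rdiag t2 = 1%:M by exact: mulmx1C.
by rewrite !mulmxA ts mul1mx -[_ *m rdiag s2 *m _]mulmxA st mulmx1.
Qed.

(** Expand [0 <= qform A (A' x - S z)] with [z = B' S^* x]. Both cross terms equal [qform B z],
    which is also the quadratic form of the left-hand side at [x], and [qform A (S z) <= qform B z]
    by hypothesis. *)
Lemma loewner_dual m n (A A' : 'M[C]_m) (B B' : 'M[C]_n) (S : 'M[C]_(m, n)) :
  A^t* = A -> B^t* = B -> psdmx A -> A *m A' = 1%:M -> B *m B' = 1%:M ->
  loewner (S^t* *m A *m S) B -> loewner (S *m B' *m S^t*) A'.
Proof.
move=> hA hB pA AA BB SAS; apply/loewnerP => x.
have hA' : A'^t* = A'.
  by rewrite -[LHS]mulmx1 -AA -{1}hA mulmxA -adjmxM AA adjmx1 mul1mx.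
have hB' : B'^t* = B'.
  by rewrite -[LHS]mulmx1 -BB -{1}hB mulmxA -adjmxM BB adjmx1 mul1mx.
set z := B' *m (S^t* *m x).
have h1 : qform A (A' *m x - S *m z) >= 0 := pA _.
have Ez : qform (S *m B' *m S^t*) x = qform B z.
  rewrite {1}/qform /z /qform !adjmxM trmxCK hB' !mulmxA.
  by rewrite -[_ *m B' *m B]mulmxA (mulmx1C BB) mulmx1.
have Ea : qform A' x = qform A (A' *m x).
  by rewrite -qform_congr hA' (mulmx1C AA) mul1mx.
have Es : qform A (S *m z) <= qform B z.
  by rewrite -qform_congr; move/loewnerP: SAS; apply.
move: h1; rewrite qformDr -scaleN1r qformZr normrN normr1 expr1n mul1r.
rewrite adjmxZ rmorphN rmorph1 -scalemxAr -2!scalemxAl !mxZE.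
have c1 : ((A' *m x)^t* *m A *m (S *m z)) 0 0 = qform B z.
  rewrite -Ez /qform /z adjmxM hA' -[_ *m A' *m A]mulmxA (mulmx1C AA) mulmx1.
  by rewrite !mulmxA.
have c2 : ((S *m z)^t* *m A *m (A' *m x)) 0 0 = qform B z.
  rewrite -Ez /qform /z !adjmxM trmxCK hB' !mulmxA.
  by rewrite -[_ *m A *m A']mulmxA AA mulmx1.
rewrite c1 c2 -Ea Ez => h1; rewrite -subr_ge0.
have -> : qform A' x - qform B z = qform A' x + qform A (S *m z) +
    (-1 * qform B z + -1 * qform B z) + (qform B z - qform A (S *m z)) by ring.
by rewrite addr_ge0 // subr_ge0.
Qed.

End FunctionalCalculus.

(** * Metrics defined by an operator monotone function *)

Section SuperOperators.
Context {C : numClosedFieldType}.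
Implicit Types g : C -> C.

Lemma eq_row_mulmx m n (A B : 'M[C]_(m, n)) :
  (forall v : 'rV_m, v *m A = v *m B) -> A = B.
Proof. by move=> AB; apply/row_matrixP => i; rewrite !rowE AB. Qed.

Lemma mxtrace_adjM m n (X Y : 'M[C]_(m, n)) :
  \tr (X^t* *m Y) = \sum_i \sum_j (X i j)^* * Y i j.
Proof.
rewrite exchange_big; apply: eq_bigr => j _; rewrite mxE; apply: eq_bigr => i _.
by rewrite !mxE.
Qed.

Lemma mxvec_dot m n (X Y : 'M[C]_(m, n)) :
  (mxvec Y *m (mxvec X)^t*) 0 0 = \tr (X^t* *m Y).
Proof.
rewrite mxtrace_adjM mxE (reindex _ (curry_mxvec_bij m n)) /= pair_bigA /=.
by apply: eq_bigr => -[i j] _; rewrite !mxE !mxvecE mulrC.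
Qed.

Definition sandwich m n p q (A : 'M[C]_(p, m)) (B : 'M[C]_(n, q)) :
  'M[C]_(m * n, p * q) := lin_mx (mulmxr B \o mulmx A).

Lemma mxvec_sandwich m n p q (A : 'M[C]_(p, m)) (B : 'M[C]_(n, q)) X :
  mxvec X *m sandwich A B = mxvec (A *m X *m B).
Proof. by rewrite mul_vec_lin. Qed.

Lemma sandwich_adj m n p q (A : 'M[C]_(p, m)) (B : 'M[C]_(n, q)) :
  (sandwich A B)^t* = sandwich (A^t*) (B^t*).
Proof.
apply: eq_row_mulmx => v; rewrite -[v]vec_mxK; set Y := vec_mx v.
apply/rowP => k; pose e : 'rV[C]_(m * n) := delta_mx 0 k.
have entry (u : 'rV[C]_(m * n)) : (u *m e^t*) 0 0 = u 0 k.
  by rewrite trmx_delta map_delta_mx -colE mxE.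
rewrite -!entry -[e]vec_mxK mxvec_sandwich mxvec_dot -mulmxA -adjmxM mxvec_sandwich.
rewrite mxvec_dot !adjmxM -!mulmxA mxtrace_mulC -!mulmxA; congr (\tr _).
Qed.

(** Schur multiplication by [w] on flattened matrices. At a diagonal state, left and right
    multiplication have this form with [w i j] equal to [p i] and [p j]. *)
Definition hdiag m n (w : 'I_m -> 'I_n -> C) : 'M[C]_(m * n) :=
  rdiag (fun k => mxvec (\matrix_(i, j) w i j) 0 k).

Lemma mxvec_hdiag m n (w : 'I_m -> 'I_n -> C) X :
  mxvec X *m hdiag w = mxvec (\matrix_(i, j) (w i j * X i j)).
Proof.
rewrite /hdiag mul_mx_diag; apply/rowP => k; case/mxvec_indexP: k => i j.
by rewrite mxE mxE !mxvecE !mxE mulrC.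
Qed.

Lemma hdiag_entry m n (P : C -> Prop) (w : 'I_m -> 'I_n -> C) :
  (forall i j, P (w i j)) -> forall k, P (mxvec (\matrix_(i, j) w i j) 0 k).
Proof. by move=> Pw k; case/mxvec_indexP: k => i j; rewrite mxvecE mxE. Qed.

Lemma rdiag_hdiag m n (h : C -> C) (w : 'I_m -> 'I_n -> C) :
  rdiag (fun k => h (mxvec (\matrix_(i, j) w i j) 0 k)) =
  hdiag (fun i j => h (w i j)).
Proof.
rewrite /hdiag /rdiag; congr diag_mx; apply/rowP => k.
by case/mxvec_indexP: k => i j; rewrite !mxE !mxvecE !mxE.
Qed.

Lemma rdiag_hdiag2 m n (h : C -> C -> C) (v w : 'I_m -> 'I_n -> C) :
  rdiag (fun k => h (mxvec (\matrix_(i, j) v i j) 0 k)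
                    (mxvec (\matrix_(i, j) w i j) 0 k)) =
  hdiag (fun i j => h (v i j) (w i j)).
Proof.
rewrite /hdiag /rdiag; congr diag_mx; apply/rowP => k.
by case/mxvec_indexP: k => i j; rewrite !mxE !mxvecE !mxE.
Qed.

Lemma hdiagM m n (v w : 'I_m -> 'I_n -> C) :
  hdiag v *m hdiag w = hdiag (fun i j => v i j * w i j).
Proof. by rewrite {1 2}/hdiag rdiagM -(rdiag_hdiag2 *%R). Qed.

Lemma eq_hdiag m n (v w : 'I_m -> 'I_n -> C) :
  (forall i j, v i j = w i j) -> hdiag v = hdiag w.
Proof.
move=> vw; rewrite /hdiag /rdiag; congr diag_mx; apply/rowP => k.
by case/mxvec_indexP: k => i j; rewrite !mxE !mxvecE !mxE.
Qed.

Lemma hdiag1 m n (w : 'I_m -> 'I_n -> C) : (forall i j, w i j = 1) -> hdiag w = 1%:M.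
Proof. by move=> w1; apply/rdiag1/(hdiag_entry (P := fun z => z = 1)). Qed.

Definition wform n (w : 'I_n -> 'I_n -> C) (X Y : 'M[C]_n) : C :=
  \sum_i \sum_j w i j * ((X i j)^* * Y i j).

Lemma hdiag_wform n (w : 'I_n -> 'I_n -> C) (X Y : 'M[C]_n) :
  (mxvec Y *m hdiag w *m (mxvec X)^t*) 0 0 = wform w X Y.
Proof.
rewrite mxvec_hdiag mxvec_dot mxtrace_adjM.
by do 2![apply: eq_bigr => ? _]; rewrite mxE mulrCA.
Qed.

Lemma qform_hdiag n (w : 'I_n -> 'I_n -> C) (X : 'M[C]_n) :
  qform (hdiag w) ((mxvec X)^t*) = wform w X X.
Proof. by rewrite /qform trmxCK hdiag_wform. Qed.

Definition modulus n (rho : 'M[C]_n) : 'M[C]_(n * n) :=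
  invmx (lin_mulmxr rho) *m lin_mulmx rho.

Definition metric_operator g n (rho : 'M[C]_n) : 'M[C]_(n * n) :=
  fcalc g (modulus rho) *m lin_mulmxr rho.

(** The inverse eigenvalue of [R g(L R^-1)] on the matrix unit [E_ij] at the diagonal state [p]: the
    Morozova-Chentsov function of the pair [(p i, p j)]. *)
Definition mweight g n (p : 'I_n -> C) (i j : 'I_n) : C := (p j * g (p i / p j))^-1.

Section Diagonalized.
Variables (n : nat) (U : 'M[C]_n).
Hypothesis uU : unitary U.

Let V : 'M[C]_(n * n) := sandwich (U^t*) U.

Lemma sandwich_unitary : unitary V.
Proof.
apply: eq_row_mulmx => v; rewrite -[v]vec_mxK mulmx1 mulmxA sandwich_adj trmxCK.
rewrite !mxvec_sandwich; congr mxvec.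
by rewrite !mulmxA uU mul1mx -mulmxA uU mulmx1.
Qed.

(** Go to the eigenbasis, multiply entrywise, come back. Left and right multiplication by
    [U^t* *m rdiag p *m U] are both of this form, so products, inverses and functional calculus are
    computed on weights. *)
Let hop w := V^t* *m hdiag w *m V.

Lemma hopM v w : hop v *m hop w = hop (fun i j => v i j * w i j).
Proof.
rewrite /hop -hdiagM !mulmxA; congr (_ *m _ *m _).
by rewrite -[_ *m V *m _]mulmxA unitaryC ?mulmx1 //; apply: sandwich_unitary.
Qed.

Lemma hop1 w : (forall i j, w i j = 1) -> hop w = 1%:M.
Proof.
move=> w1; rewrite /hop (_ : hdiag w = 1%:M) ?mulmx1; first exact: sandwich_unitary.
exact: hdiag1.
Qed.

Lemma hopV w : (forall i j, w i j != 0) -> invmx (hop w) = hop (fun i j => (w i j)^-1).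
Proof.
move=> w0; have h : hop (fun i j => (w i j)^-1) *m hop w = 1%:M.
  by rewrite hopM hop1 // => i j; rewrite mulVf.
have [_ uw] := mulmx1_unit h.
by rewrite -[RHS]mulmx1 -(mulmxV uw) mulmxA h mul1mx.
Qed.

Lemma lin_mulmx_hop (p : 'I_n -> C) :
  lin_mulmx (U^t* *m rdiag p *m U) = hop (fun i _ => p i).
Proof.
apply: eq_row_mulmx => v; rewrite -[v]vec_mxK; set Y := vec_mx v.
rewrite mul_vec_lin /hop !mulmxA sandwich_adj trmxCK mxvec_sandwich mxvec_hdiag.
rewrite mxvec_sandwich; congr mxvec; rewrite /=.
have -> : \matrix_(i, j) (p i * (U *m Y *m U^t*) i j) = rdiag p *m (U *m Y *m U^t*).
  by rewrite mul_diag_mx; apply/matrixP => i j; rewrite !mxE.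
by rewrite !mulmxA -[_ *m U^t* *m U]mulmxA uU mulmx1.
Qed.

Lemma lin_mulmxr_hop (p : 'I_n -> C) :
  lin_mulmxr (U^t* *m rdiag p *m U) = hop (fun _ j => p j).
Proof.
apply: eq_row_mulmx => v; rewrite -[v]vec_mxK; set Y := vec_mx v.
rewrite mul_vec_lin /hop !mulmxA sandwich_adj trmxCK mxvec_sandwich mxvec_hdiag.
rewrite mxvec_sandwich; congr mxvec; rewrite /=.
have -> : \matrix_(i, j) (p j * (U *m Y *m U^t*) i j) = U *m Y *m U^t* *m rdiag p.
  by rewrite mul_mx_diag; apply/matrixP => i j; rewrite !mxE mulrC.
by rewrite !mulmxA uU mul1mx.
Qed.

Lemma metric_operator_form g (p : 'I_n -> C) X Y :
  (forall x, 0 < x -> 0 < g x) -> (forall i, 0 < p i) ->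
  \tr (X^t* *m vec_mx (mxvec Y *m invmx (metric_operator g (U^t* *m rdiag p *m U)))) =
  wform (mweight g p) (U *m X *m U^t*) (U *m Y *m U^t*).
Proof.
move=> g0 p0; have pn0 i : p i != 0 by rewrite gt_eqF.
have q0 i j : 0 < (p j)^-1 * p i by rewrite mulr_gt0 ?invr_gt0.
rewrite /metric_operator /modulus lin_mulmx_hop lin_mulmxr_hop hopV // hopM.
rewrite /hop fcalc_rdiag; last 2 first.
- exact: sandwich_unitary.
- by apply: (hdiag_entry (P := fun z => z \is Num.real)) => i j; rewrite gtr0_real.
rewrite rdiag_hdiag -!/(hop _) hopM hopV; last first.
  by move=> i j; rewrite mulf_neq0 // gt_eqF // g0.
have E Z : mxvec (U *m Z *m U^t*) = mxvec Z *m V^t*.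
  by rewrite sandwich_adj trmxCK mxvec_sandwich.
rewrite -mxvec_dot vec_mxK -hdiag_wform !E adjmxM trmxCK /hop !mulmxA.
rewrite (@eq_hdiag _ _ (mweight g p) (fun i j => (g ((p j)^-1 * p i) * p j)^-1)) //.
by move=> i j; rewrite /mweight mulrC [p i / _]mulrC.
Qed.

End Diagonalized.

(** * Completely positive maps and monotonicity in eigenbases *)

Section CompletelyPositive.
Variables (n m k : nat) (A : 'I_k -> 'M[C]_(m, n)).

Definition kraus (X : 'M[C]_n) : 'M[C]_m := \sum_i A i *m X *m (A i)^t*.

Definition kraus_adj (Y : 'M[C]_m) : 'M[C]_n := \sum_i (A i)^t* *m Y *m A i.

(** From the right it acts on flattened rows as [kraus], hence from the left it acts on columns
    [(mxvec Y)^t*] as [kraus_adj]. It is the [S] to which [mean_transform] is applied. *)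
Definition krausmx : 'M[C]_(n * n, m * m) := \sum_i sandwich (A i) ((A i)^t*).

Lemma mxvec_kraus X : mxvec X *m krausmx = mxvec (kraus X).
Proof.
rewrite mulmx_sumr linear_sum; apply: eq_bigr => i _; exact: mxvec_sandwich.
Qed.

Lemma mxvec_kraus_adj Y : mxvec Y *m krausmx^t* = mxvec (kraus_adj Y).
Proof.
have -> : krausmx^t* = \sum_i sandwich ((A i)^t*) (A i).
  rewrite /krausmx linear_sum map_mx_sum; apply: eq_bigr => i _.
  by rewrite sandwich_adj trmxCK.
rewrite mulmx_sumr linear_sum; apply: eq_bigr => i _; exact: mxvec_sandwich.
Qed.

Lemma kraus_adjC Y : (kraus_adj Y)^t* = kraus_adj (Y^t*).
Proof.
rewrite /kraus_adj linear_sum map_mx_sum; apply: eq_bigr => i _.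
by rewrite !adjmxM trmxCK mulmxA.
Qed.

Lemma kraus_adjP X Y : \tr (X *m kraus_adj Y) = \tr (kraus X *m Y).
Proof.
rewrite /kraus /kraus_adj mulmx_sumr mulmx_suml !linear_sum; apply: eq_bigr => i _ /=.
by rewrite !mulmxA mxtrace_mulC !mulmxA.
Qed.

Hypothesis subunital : loewner (\sum_i (A i)^t* *m A i) 1%:M.

Lemma kadison_schwarz Y :
  loewner ((kraus_adj Y)^t* *m kraus_adj Y) (kraus_adj (Y^t* *m Y)).
Proof.
move defS: (kraus_adj Y) => S.
(* The gap in the inequality is the sum of the Gram matrices of the [Z i] plus the compression by
   [S] of the defect [1 - \sum_i A_i^* A_i]; both are positive. *)
pose Z i := Y *m A i - A i *m S.
rewrite /loewner.
have -> : kraus_adj (Y^t* *m Y) - S^t* *m S =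
    \sum_i (Z i)^t* *m Z i + S^t* *m (1%:M - \sum_i (A i)^t* *m A i) *m S.
  rewrite mulmxBr mulmxBl mulmx1 mulmx_sumr mulmx_suml.
  have -> : \sum_i (Z i)^t* *m Z i = \sum_i (A i)^t* *m (Y^t* *m Y) *m A i
     - \sum_i ((A i)^t* *m Y^t* *m A i) *m S - \sum_i S^t* *m ((A i)^t* *m Y *m A i)
     + \sum_i S^t* *m ((A i)^t* *m A i) *m S.
    rewrite -!sumrB -big_split; apply: eq_bigr => i _ /=.
    rewrite /Z adjmxB !adjmxM mulmxBr !mulmxBl !mulmxA opprB addrA addrAC.
    by congr (_ + _); rewrite addrAC.
  rewrite -mulmx_suml -mulmx_sumr -/(kraus_adj _) -/(kraus_adj _) -/(kraus_adj _)
    -kraus_adjC defS.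
  by rewrite addrACA subrr addr0 -addrA addNr addr0.
apply: psdD; last exact: psd_congr.
move=> x; rewrite qform_sum sumr_ge0 // => i _; exact: psd_gram.
Qed.

Lemma mxtrace_psd_ge0 l (P : 'M[C]_l) : psdmx P -> 0 <= \tr P.
Proof. by move=> pP; apply: sumr_ge0 => i _; rewrite -qform_delta pP. Qed.

(** Kadison-Schwarz traced against [rho], then the duality [kraus_adjP], then [kraus rho <= omega].
    This compares the right multiplications; putting the adjoint of [Y] in place of [Y] compares the
    left ones. *)
Lemma kraus_adj_trace (rho : 'M[C]_n) (omega : 'M[C]_m) Y :
  psdmx rho -> loewner (kraus rho) omega ->
  \tr (rho *m ((kraus_adj Y)^t* *m kraus_adj Y)) <= \tr (omega *m (Y^t* *m Y)).
Proof.
move=> prho le.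
have h1 : \tr (rho *m ((kraus_adj Y)^t* *m kraus_adj Y)) <=
    \tr (rho *m kraus_adj (Y^t* *m Y)).
  rewrite -subr_ge0 -linearB -mulmxBr /=.
  have [D <-] := psd_factor prho.
  rewrite -mulmxA mxtrace_mulC -[D in D *m _ *m _]trmxCK.
  exact/mxtrace_psd_ge0/psd_congr/kadison_schwarz.
apply: le_trans h1 _; rewrite kraus_adjP -subr_ge0 -linearB -mulmxBl /=.
rewrite mulmxA mxtrace_mulC mulmxA -[Y in Y *m _ *m _]trmxCK.
exact/mxtrace_psd_ge0/psd_congr.
Qed.

Lemma tr_rdiag_gram l (q : 'I_l -> C) (Y : 'M[C]_l) :
  \tr (rdiag q *m (Y^t* *m Y)) = wform (fun _ j => q j) Y Y.
Proof.
rewrite /wform exchange_big; apply: eq_bigr => j _; rewrite mul_diag_mx !mxE mulr_sumr.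
by apply: eq_bigr => i _; rewrite !mxE.
Qed.

Lemma wform_adj l (w : 'I_l -> 'I_l -> C) (Y : 'M[C]_l) :
  wform w (Y^t*) (Y^t*) = wform (fun i j => w j i) Y Y.
Proof.
rewrite /wform exchange_big; do 2![apply: eq_bigr => ? _].
by rewrite !mxE conjCK mulrC [X in X * _]mulrC mulrC.
Qed.

Lemma wform_monotone_diag g (p : 'I_n -> C) (q : 'I_m -> C) X :
  opmonotone g -> (0 < m)%N -> (forall i, 0 < p i) -> (forall i, 0 < q i) ->
  loewner (kraus (rdiag p)) (rdiag q) ->
  wform (mweight g q) (kraus X) (kraus X) <= wform (mweight g p) X X.
Proof.
move=> og m0 p0 q0 le; have [g0 _] := og.
have pp : psdmx (rdiag p) by apply/pd_psd/pd_rdiag.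
have mm0 : (0 < m * m)%N by rewrite muln_gt0 m0.
have loewner_h u v : (forall Y, wform u (kraus_adj Y) (kraus_adj Y) <= wform v Y Y) ->
    loewner (krausmx^t* *m hdiag u *m krausmx) (hdiag v).
  move=> h; apply/loewnerP => x; rewrite qform_congr.
  have -> : x = (mxvec (vec_mx (x^t*)))^t* by rewrite vec_mxK trmxCK.
  set Y := vec_mx _; have -> : krausmx *m (mxvec Y)^t* = (mxvec (kraus_adj Y))^t*.
    by rewrite -mxvec_kraus_adj adjmxM trmxCK.
  by rewrite !qform_hdiag.
have hR := loewner_h (fun _ j => p j) (fun _ j => q j).
have hL := loewner_h (fun i _ => p i) (fun i _ => q i).
have KS Y : wform (fun _ j => p j) (kraus_adj Y) (kraus_adj Y) <= wform (fun _ j => q j) Y Y.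
  by rewrite -!tr_rdiag_gram; apply: kraus_adj_trace.
have {}hR := hR KS.
have {}hL : loewner (krausmx^t* *m hdiag (fun i _ => p i) *m krausmx) (hdiag (fun i _ => q i)).
  by apply: hL => Y; have := KS (Y^t*); rewrite -kraus_adjC !wform_adj.
(* The comparisons of [L] and [R] pass to [R g(L R^-1)]. Below, [loewner_dual] inverts these
   operators and thereby replaces [kraus_adj] by [kraus]. *)
have := mean_transform og mm0 _ _ _ _ hL hR.
rewrite !(rdiag_hdiag2 (fun l r => r * g (l / r))) => h.
have {h} := h (hdiag_entry (P := fun z => 0 < z) _) (hdiag_entry (P := fun z => 0 < z) _)
  (hdiag_entry (P := fun z => 0 < z) _) (hdiag_entry (P := fun z => 0 < z) _).
move=> /(_ (fun i _ => p0 i) (fun _ => p0) (fun i _ => q0 i) (fun _ => q0)).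
have pw l (r : 'I_l -> C) : (forall i, 0 < r i) ->
    pdmx (hdiag (fun i j => r j * g (r i / r j))).
  move=> r0; apply/pd_rdiag/(hdiag_entry (P := fun z => 0 < z)) => i j.
  by rewrite mulr_gt0 // g0 // divr_gt0.
have pV l (r : 'I_l -> C) : (forall i, 0 < r i) ->
    hdiag (fun i j => r j * g (r i / r j)) *m hdiag (mweight g r) = 1%:M.
  move=> r0; rewrite hdiagM hdiag1 // => i j; rewrite divff // mulf_neq0 ?gt_eqF //.
  by rewrite g0 // divr_gt0.
move/(loewner_dual (pd_hermitian (pw _ _ p0)) (pd_hermitian (pw _ _ q0))
  (pd_psd (pw _ _ p0)) (pV _ _ p0) (pV _ _ q0)).
move/loewnerP/(_ ((mxvec X)^t*)); rewrite -{1}[krausmx]trmxCK qform_congr.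
by rewrite -adjmxM mxvec_kraus !qform_hdiag.
Qed.

End CompletelyPositive.
End SuperOperators.

(** * Inner products on operators, and the metric attached to a function *)

Section InnerProducts.
Context {C : numClosedFieldType}.
Implicit Types g : C -> C.

Lemma conjCN (x : C) : (- x)^* = - x^*.
Proof. exact: rmorphN. Qed.

Lemma conjCD (x y : C) : (x + y)^* = x^* + y^*.
Proof. exact: rmorphD. Qed.

Lemma conjCM (x y : C) : (x * y)^* = x^* * y^*.
Proof. exact: rmorphM. Qed.

Definition inner_product n (k : 'M[C]_n -> 'M[C]_n -> C) : Prop :=
  [/\ forall a X Y Z, k X (a *: Y + Z) = a * k X Y + k X Z,
      forall a X Y Z, k (a *: X + Y) Z = a^* * k X Z + k Y Z,
      forall X Y, k Y X = (k X Y)^*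
    & forall X, X != 0 -> 0 < k X X].

Section Theory.
Variables (n : nat) (k : 'M[C]_n -> 'M[C]_n -> C).
Hypothesis ik : inner_product k.

Lemma inner0r X : k X 0 = 0.
Proof.
have [kr _ _ _] := ik; have := kr 1 X 0 0.
by rewrite scale1r addr0 mul1r => /eqP; rewrite -subr_eq0 opprD addNKr oppr_eq0 => /eqP.
Qed.

Lemma innerC X Y : k Y X = (k X Y)^*.
Proof. by case: ik. Qed.

Lemma innerDr X Y Z : k X (Y + Z) = k X Y + k X Z.
Proof. by case: ik => kr _ _ _; rewrite -[Y]scale1r kr mul1r scale1r. Qed.

Lemma innerZr a X Y : k X (a *: Y) = a * k X Y.
Proof. by case: ik => kr _ _ _; rewrite -[a *: Y]addr0 kr inner0r addr0. Qed.

Lemma innerDl X Y Z : k (X + Y) Z = k X Z + k Y Z.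
Proof. by rewrite innerC innerDr conjCD -!innerC. Qed.

Lemma innerZl a X Y : k (a *: X) Y = a^* * k X Y.
Proof. by rewrite innerC innerZr conjCM -innerC. Qed.

Lemma inner0l X : k 0 X = 0.
Proof. by rewrite innerC inner0r rmorph0. Qed.

Lemma inner_ge0 X : 0 <= k X X.
Proof.
have [->|X0] := eqVneq X 0; first by rewrite inner0r.
by case: ik => _ _ _ pk; apply/ltW/pk.
Qed.

Lemma inner_expand a X Y : k (X + a *: Y) (X + a *: Y) =
  k X X + (a * k X Y + a^* * k Y X) + a * a^* * k Y Y.
Proof. by rewrite innerDl !innerDr innerZl innerZl !innerZr; ring. Qed.

Lemma innerZ2 a X : k (a *: X) (a *: X) = `|a| ^+ 2 * k X X.
Proof. by rewrite innerZl innerZr normCK mulrCA mulrA. Qed.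

Lemma orthogonal_of_min X Y :
  (forall a, k X X <= k (X + a *: Y) (X + a *: Y)) -> k X Y = 0.
Proof.
move=> min; apply/eqP; apply: contraT => w0.
have Y0 : Y != 0 by apply: contra w0 => /eqP ->; rewrite inner0r.
have kY : 0 < k Y Y by case: ik => _ _ _; apply.
(* This [a] minimizes the quadratic, whose value there lies below [k X X] by [|k X Y|^2 / k Y Y]. *)
have := min (- (k Y Y)^-1 * (k X Y)^*).
rewrite inner_expand -addrA lerDl conjCM conjCK conjCN.
rewrite (conj_Creal (rpredVr (gtr0_real kY))) [k Y X]innerC.
have -> : - (k Y Y)^-1 * (k X Y)^* * k X Y + - (k Y Y)^-1 * k X Y * (k X Y)^* +
    - (k Y Y)^-1 * (k X Y)^* * (- (k Y Y)^-1 * k X Y) * k Y Y =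
  - ((k Y Y)^-1 * (k X Y * (k X Y)^*)) by field; rewrite gt_eqF.
rewrite -normCK oppr_ge0 pmulr_rle0 ?invr_gt0 //.
have kXY : 0 < `|k X Y| ^+ 2 by rewrite exprn_gt0 // normr_gt0.
by move=> /(lt_le_trans kXY); rewrite ltxx.
Qed.

Lemma orthogonal_of_sym X Y :
  (forall a, k (X + a *: Y) (X + a *: Y) = k (X - a *: Y) (X - a *: Y)) -> k X Y = 0.
Proof.
(* For this [a] the two sides differ by [4 |k X Y|^2]. *)
move=> sym; have := sym (k X Y)^*; rewrite -scaleNr !inner_expand.
rewrite conjCN conjCK [k Y X]innerC => /eqP; rewrite -subr_eq0.
set a := k X Y; set d := _ - _.
have -> : d = (a * a^*) *+ 4 by rewrite /d; ring.
by rewrite mulrn_eq0 /= -normCK expf_eq0 /= normr_eq0 => /eqP.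
Qed.

End Theory.

Lemma inner_product_eq n (k h : 'M[C]_n -> 'M[C]_n -> C) :
  inner_product k -> inner_product h -> (forall X, k X X = h X X) ->
  forall X Y, k X Y = h X Y.
Proof.
move=> ik ih kh X Y.
have cross a : a * k X Y + a^* * k Y X = a * h X Y + a^* * h Y X.
  have := kh (X + a *: Y); rewrite (inner_expand ik) (inner_expand ih) !kh.
  by move=> /addIr /addrI.
have c1 := cross 1; have ci := cross 'i.
rewrite conjC1 !mul1r in c1; rewrite conjCi !mulNr -!mulrBr in ci.
have {}ci := mulfI (neq0Ci C) ci.
have : k X Y *+ 2 = h X Y *+ 2.
  have -> : k X Y *+ 2 = (k X Y + k Y X) + (k X Y - k Y X) by ring.
  by rewrite c1 ci; ring.
by move/eqP; rewrite -subr_eq0 -mulrnBl mulrn_eq0 /= subr_eq0 => /eqP.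
Qed.

Lemma wform_inner n (w : 'I_n -> 'I_n -> C) :
  (forall i j, 0 < w i j) -> inner_product (wform w).
Proof.
move=> w0; split=> [a X Y Z|a X Y Z|X Y|X X0].
- rewrite /wform mulr_sumr -big_split; apply: eq_bigr => i _.
  rewrite mulr_sumr -big_split; apply: eq_bigr => j _ /=.
  by rewrite !mxE; ring.
- rewrite /wform mulr_sumr -big_split; apply: eq_bigr => i _.
  rewrite mulr_sumr -big_split; apply: eq_bigr => j _ /=.
  by rewrite !mxE conjCD conjCM; ring.
- rewrite /wform rmorph_sum; apply: eq_bigr => i _.
  rewrite rmorph_sum; apply: eq_bigr => j _ /=.
  by rewrite !conjCM conjCK (conj_Creal (gtr0_real (w0 i j))) [X i j * _]mulrC.
have t0 i j : 0 <= w i j * ((X i j)^* * X i j).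
  by rewrite mulrC [_ * X i j]mulrC -normCK mulr_ge0 ?exprn_ge0 // ltW.
rewrite lt0r /wform sumr_ge0 => [|i _]; last by apply: sumr_ge0.
rewrite andbT; apply: contra X0 => /eqP s0; apply/eqP/matrixP => i j; rewrite mxE.
have s1 := psumr_eq0P (fun i _ => sumr_ge0 _ (fun j _ => t0 i j)) s0.
have /eqP := psumr_eq0P (fun j _ => t0 i j) (s1 i isT) (isT : xpredT j).
rewrite mulf_eq0 gt_eqF //= mulf_eq0 conjC_eq0 orbb => /eqP //.
Qed.

Lemma inner_unitary n (k : 'M[C]_n -> 'M[C]_n -> C) U :
  unitary U -> inner_product k ->
  inner_product (fun X Y => k (U *m X *m U^t*) (U *m Y *m U^t*)).
Proof.
move=> uU [kr kl kC kp]; split=> [a X Y Z|a X Y Z|X Y|X X0].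
- by rewrite mulmxDr mulmxDl -scalemxAr -scalemxAl kr.
- by rewrite mulmxDr mulmxDl -scalemxAr -scalemxAl kl.
- exact: kC.
apply: kp; apply: contra X0 => /eqP UX.
have := unitary_conjK X (unitary_adj uU); rewrite trmxCK => <-.
by rewrite UX mulmx0 mul0mx.
Qed.

Definition metric_form g n (rho X Y : 'M[C]_n) : C :=
  \tr (X^t* *m vec_mx (mxvec Y *m invmx (metric_operator g rho))).

Lemma mweight_gt0 g n (p : 'I_n -> C) i j :
  (forall x, 0 < x -> 0 < g x) -> (forall i, 0 < p i) -> 0 < mweight g p i j.
Proof. by move=> g0 p0; rewrite invr_gt0 mulr_gt0 // g0 // divr_gt0. Qed.

Lemma eq_inner_product n (k h : 'M[C]_n -> 'M[C]_n -> C) :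
  (forall X Y, k X Y = h X Y) -> inner_product h -> inner_product k.
Proof. by move=> kh [hr hl hC hp]; split=> *; rewrite !kh //; apply: hp. Qed.

Lemma metric_form_inner g n (rho : 'M[C]_n) :
  (forall x, 0 < x -> 0 < g x) -> pdmx rho -> inner_product (metric_form g rho).
Proof.
move=> g0 /pd_spectral[U [p [uU p0 ->]]].
apply: eq_inner_product (inner_unitary uU (wform_inner (fun i j => mweight_gt0 i j g0 p0))).
by move=> X Y; apply: metric_operator_form.
Qed.

Lemma metric_form_monotone g n m k (A : 'I_k -> 'M[C]_(m, n)) X rho sigma :
  opmonotone g -> (0 < m)%N -> loewner (\sum_i (A i)^t* *m A i) 1%:M ->
  pdmx rho -> psdmx sigma -> pdmx (kraus A rho + sigma) ->
  metric_form g (kraus A rho + sigma) (kraus A X) (kraus A X) <= metric_form g rho X X.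
Proof.
move=> og m0 subA prho psigma /pd_spectral[W [q [uW q0 domega]]].
have [g0 _] := og; have [U [p [uU p0 drho]]] := pd_spectral prho.
(* The same map written in the eigenbases of [rho] and of the output state, so that both states
   become diagonal. *)
pose A' i := W *m A i *m U^t*.
have kA' Z : kraus A' (U *m Z *m U^t*) = W *m kraus A Z *m W^t*.
  rewrite /kraus mulmx_sumr mulmx_suml; apply: eq_bigr => i _.
  rewrite /A' !adjmxM trmxCK !mulmxA -[_ *m U^t* *m U]mulmxA uU mulmx1.
  by rewrite -[_ *m U^t* *m U]mulmxA uU mulmx1.
have pdmx' : rdiag p = U *m rho *m U^t* by rewrite drho unitary_conjK.
have qd' : rdiag q = W *m (kraus A rho + sigma) *m W^t*.
  by rewrite domega unitary_conjK.
rewrite domega drho /metric_form !metric_operator_form // -!kA'.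
apply: wform_monotone_diag => //.
  have -> : \sum_i (A' i)^t* *m A' i = (U^t*)^t* *m (\sum_i (A i)^t* *m A i) *m U^t*.
    rewrite trmxCK mulmx_sumr mulmx_suml; apply: eq_bigr => i _.
    by rewrite /A' !adjmxM trmxCK !mulmxA -[_ *m W^t* *m W]mulmxA uW mulmx1.
  by have := psd_congr (U^t*) subA; rewrite mulmxBr mulmxBl mulmx1 trmxCK unitaryC //.
rewrite pdmx' kA' qd' /loewner -mulmxBl -mulmxBr addrC addKr.
by rewrite -{1}[W]trmxCK; apply: psd_congr.
Qed.

End InnerProducts.

(** * Structure of monotone metrics *)

Section AdditiveFunctions.
Context {C : numClosedFieldType}.
Hypothesis arch : forall x : C, 0 <= x -> exists n : nat, x < n%:R.
Variable phi : C -> C.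
Hypothesis phi_ge0 : forall t, 0 < t -> t <= 1 -> 0 <= phi t.
Hypothesis phiD : forall s t, 0 < s -> 0 < t -> s + t <= 1 -> phi (s + t) = phi s + phi t.

Let phi_mono s t : 0 < s -> s <= t -> t <= 1 -> phi s <= phi t.
Proof.
move=> s0; rewrite le_eqVlt => /orP[/eqP -> //|st t1].
have ts0 : 0 < t - s by rewrite subr_gt0.
have := phiD s0 ts0; rewrite addrC subrK => ->; last exact: t1.
rewrite lerDl; apply: phi_ge0 => //.
by apply: le_trans t1; rewrite lerBlDr lerDl ltW.
Qed.

Let phi_natM s n : (0 < n)%N -> 0 < s -> s *+ n <= 1 -> phi (s *+ n) = phi s *+ n.
Proof.
move=> n0 s0; elim: n n0 => // -[|n] IH _ sn; first by rewrite !mulr1n.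
rewrite mulrS [in RHS]mulrS phiD // -?mulrS ?pmulrn_lgt0 // IH //.
by apply: le_trans sn; rewrite [leRHS]mulrS lerDr ltW.
Qed.

Let phi_ratio (m n : nat) : (0 < m <= n)%N -> phi (m%:R / n%:R) = m%:R / n%:R * phi 1.
Proof.
move=> /andP[m0 mn]; have n0 : (0 < n)%N := leq_trans m0 mn.
have nC : (n%:R : C) != 0 by rewrite pnatr_eq0 -lt0n.
have i0 : 0 < (n%:R : C)^-1 by rewrite invr_gt0 ltr0n.
have h1 : phi 1 = phi n%:R^-1 *+ n.
  have {1}-> : (1 : C) = n%:R^-1 *+ n by rewrite -[RHS]mulr_natr mulVf.
  by rewrite phi_natM // -[leLHS]mulr_natr mulVf.
have -> : m%:R / n%:R = n%:R^-1 *+ m :> C by rewrite -[RHS]mulr_natl.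
rewrite phi_natM //; last by rewrite -[leLHS]mulr_natl ler_pdivrMr ?ltr0n // mul1r ler_nat.
rewrite h1 mulrnAl mulrnAr -mulrnAl -[_^-1 *+ n]mulr_natr mulVf //.
by rewrite mul1r.
Qed.

(* Squeeze [t] between consecutive fractions of denominator [n]. *)
Lemma additive_nonneg_linear t : 0 < t -> t <= 1 -> phi t = t * phi 1.
Proof.
move=> t0 t1; have p1 : 0 <= phi 1 by apply: phi_ge0.
have tr : t \is Num.real by rewrite gtr0_real.
have bound n : (0 < n)%N -> `|phi t - t * phi 1| * n%:R <= phi 1.
  move=> n0; have nC : 0 < (n%:R : C) by rewrite ltr0n.
  have ex : exists m, (m%:R : C) <= t * n%:R by exists 0%N; rewrite mulr_ge0 // ltW.
  have ub m : (m%:R : C) <= t * n%:R -> (m <= n)%N.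
    move=> h; rewrite -(ler_nat C); apply: le_trans h _.
    by rewrite -[leRHS]mul1r ler_wpM2r // ltW.
  case: (ex_maxnP ex ub) => m mt maxm.
  have mn := ub _ mt.
  have tm : t * n%:R < m.+1%:R.
    by rewrite real_ltNge ?rpredM ?realn //; apply/negP => /maxm; rewrite ltnn.
  have lo : t * n%:R * phi 1 - phi 1 <= phi t * n%:R.
    (* The lower fraction [0 / n] is outside the domain on which [phi] is controlled; in that case
       the left-hand side is nonpositive. *)
    have [m0|m0] := posnP m.
      apply: (@le_trans _ _ 0); last exact: mulr_ge0 (phi_ge0 t0 t1) (ltW nC).
      by rewrite subr_le0 -[leRHS]mul1r ler_wpM2r // ltW // (lt_le_trans tm) // m0.
    have mn0 : 0 < (m%:R / n%:R : C) by rewrite divr_gt0 ?ltr0n.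
    have mnt : m%:R / n%:R <= t by rewrite ler_pdivrMr.
    have := phi_mono mn0 mnt t1.
    rewrite phi_ratio ?m0 // => h.
    have {}h : m%:R * phi 1 <= phi t * n%:R.
      have := ler_wpM2r (ltW nC) h.
      by rewrite mulrAC mulfVK // gt_eqF.
    apply: le_trans h; rewrite lerBlDr -[X in _ <= _ + X]mul1r -mulrDl ler_wpM2r //.
    by rewrite natr1 ltW.
  have hi : phi t * n%:R <= t * n%:R * phi 1 + phi 1.
    (* The upper fraction [m.+1 / n] exceeds 1 only if [m = n], which forces [t = 1]. *)
    have [mn'|mn'] := leqP m.+1 n.
      have : phi t <= phi (m.+1%:R / n%:R).
        apply: phi_mono => //; first by rewrite ler_pdivlMr // ltW.
        by rewrite ler_pdivrMr // mul1r ler_nat.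
      rewrite phi_ratio ?mn' // => h.
      have {}h : phi t * n%:R <= m.+1%:R * phi 1.
        have := ler_wpM2r (ltW nC) h.
        by rewrite [X in _ <= X]mulrAC mulfVK // gt_eqF.
      apply: le_trans h _; rewrite -[X in _ <= _ + X]mul1r -mulrDl ler_wpM2r //.
      by rewrite -natr1 lerD2r.
    have <- : 1 = t.
      apply/eqP; rewrite eq_le t1 andbT -(ler_pM2r nC) mul1r.
      by apply: le_trans mt; rewrite ler_nat.
    by rewrite mul1r mulrC lerDl.
  rewrite -[X in _ * X](ger0_norm (ltW nC)) -normrM real_ler_norml; last first.
    by rewrite rpredM ?rpredB ?rpredM ?realn // ger0_real // phi_ge0.
  rewrite mulrBl [t * phi 1 * _]mulrAC.
  by rewrite lerBrDr addrC lo lerBlDl hi.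
apply/eqP; rewrite -subr_eq0 -normr_eq0; apply: contraT => d0.
have d1 : 0 < `|phi t - t * phi 1| by rewrite lt0r d0 normr_ge0.
have [n hn] := arch (divr_ge0 p1 (ltW d1)).
have n0 : (0 < n)%N.
  by rewrite -(ltr_nat C); apply: le_lt_trans hn; rewrite divr_ge0 // ltW.
move: hn; rewrite ltr_pdivrMr // mulrC => /lt_le_trans/(_ (bound n n0)).
by rewrite ltxx.
Qed.

End AdditiveFunctions.

Section MonotoneMetrics.
Context {C : numClosedFieldType}.
Hypothesis arch : forall x : C, 0 <= x -> exists n : nat, x < n%:R.
Variable K : forall n, 'M[C]_n -> 'M[C]_n -> 'M[C]_n -> C.

Definition pstate n (rho : 'M[C]_n) : Prop := \tr rho <= 1 /\ pdmx rho.

Hypothesis K_inner : forall n (rho : 'M[C]_n), (0 < n)%N -> pstate rho ->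
  inner_product (K rho).
Hypothesis K_monotone : forall n m k (A : 'I_k -> 'M[C]_(m, n)) X rho sigma,
  (0 < n)%N -> (0 < m)%N -> loewner (\sum_i (A i)^t* *m A i) 1%:M ->
  pstate rho -> \tr sigma <= 1 -> psdmx sigma -> pstate (kraus A rho + sigma) ->
  K (kraus A rho + sigma) (kraus A X) (kraus A X) <= K rho X X.

Let N n (rho X : 'M[C]_n) := K rho X X.

Lemma mxtrace_pd_gt0 n (A : 'M[C]_n) : (0 < n)%N -> pdmx A -> 0 < \tr A.
Proof.
case: n A => // n A _ pA; rewrite /mxtrace big_ord_recl ltr_wpDr //.
  by apply: sumr_ge0 => i _; rewrite -qform_delta; apply: pd_psd.
rewrite -qform_delta; apply: pA; apply/eqP => /matrixP/(_ 0 0)/eqP.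
by rewrite !mxE !eqxx oner_eq0.
Qed.

Lemma psd0 n : psdmx (0 : 'M[C]_n).
Proof. by move=> x; rewrite /qform mulmx0 mul0mx mxE. Qed.

Lemma loewner_refl n (A : 'M[C]_n) : loewner A A.
Proof. by rewrite /loewner subrr; apply: psd0. Qed.

Lemma kraus1 n m (A : 'M[C]_(m, n)) X : kraus (fun _ : 'I_1 => A) X = A *m X *m A^t*.
Proof. by rewrite /kraus big_ord1. Qed.

Lemma monotone1 n m (A : 'M[C]_(m, n)) X rho sigma :
  (0 < n)%N -> (0 < m)%N -> loewner (A^t* *m A) 1%:M -> pstate rho ->
  \tr sigma <= 1 -> psdmx sigma -> pstate (A *m rho *m A^t* + sigma) ->
  N (A *m rho *m A^t* + sigma) (A *m X *m A^t*) <= N rho X.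
Proof.
move=> n0 m0 AA prho ts ps pw.
have := @K_monotone n m 1 (fun _ => A) X rho sigma n0 m0.
by rewrite big_ord1 !kraus1; apply.
Qed.

Lemma monotone2 n m (A B : 'M[C]_(m, n)) X rho omega :
  (0 < n)%N -> (0 < m)%N -> A^t* *m A + B^t* *m B = 1%:M -> pstate rho ->
  pstate omega -> A *m rho *m A^t* + B *m rho *m B^t* = omega ->
  N omega (A *m X *m A^t* + B *m X *m B^t*) <= N rho X.
Proof.
move=> n0 m0 AA prho pw defw.
pose F (i : 'I_2) := if i == 0 then A else B.
have kF Y : kraus F Y = A *m Y *m A^t* + B *m Y *m B^t*.
  by rewrite /kraus big_ord_recl big_ord1.
have := @K_monotone n m 2 F X rho 0 n0 m0.
rewrite addr0 !kF defw big_ord_recl big_ord1 /= AA; apply=> //.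
- exact: loewner_refl.
- by rewrite mxtrace0 ler01.
exact: psd0.
Qed.

(** * Restriction of the metric to a reducing subspace *)

Section Isometry.
Variables (n m : nat) (V : 'M[C]_(n, m)) (rho : 'M[C]_n) (tau : 'M[C]_m).
Hypotheses (n0 : (0 < n)%N) (m0 : (0 < m)%N) (VV : V^t* *m V = 1%:M).
Hypotheses (prho : pstate rho) (rV : rho *m V = V *m tau).

Let Q : 'M[C]_n := 1%:M - V *m V^t*.

Let Qadj : Q^t* = Q.
Proof. by rewrite adjmxB adjmx1 adjmxM trmxCK. Qed.

Let deftau : tau = V^t* *m rho *m V.
Proof. by rewrite -mulmxA rV mulmxA VV mul1mx. Qed.

Let defS : rho = V *m tau *m V^t* + Q^t* *m rho *m Q.
Proof.
have [_ /pd_hermitian hr] := prho.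
have ht : tau^t* = tau by rewrite deftau !adjmxM trmxCK hr mulmxA.
have Vr : V^t* *m rho = tau *m V^t*.
  by have := congr1 (fun X => X^t*) rV; rewrite !adjmxM hr ht.
rewrite Qadj /Q mulmxBl mul1mx mulmxBr mulmx1 mulmxBl.
have -> : V *m V^t* *m rho = V *m tau *m V^t* by rewrite -mulmxA Vr mulmxA.
rewrite [rho *m _]mulmxA rV.
have -> : V *m tau *m V^t* *m (V *m V^t*) = V *m tau *m V^t*.
  by rewrite mulmxA -[_ *m V^t* *m V]mulmxA VV mulmx1.
by rewrite subrr subr0 addrC subrK.
Qed.

Let pS : psdmx (Q^t* *m rho *m Q).
Proof. by have [_ /pd_psd] := prho; apply: psd_congr. Qed.

Let ptau : pdmx tau.
Proof. by rewrite deftau; apply: (pd_congr_inj VV); case: prho. Qed.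

Let trS : \tr rho = \tr tau + \tr (Q^t* *m rho *m Q).
Proof.
by rewrite {1}defS raddfD /=; congr (_ + _); rewrite mxtrace_mulC mulmxA VV mul1mx.
Qed.

Lemma pstate_isometry : pstate tau.
Proof.
split; last exact: ptau; have [t1 _] := prho.
by apply: le_trans t1; rewrite trS lerDl mxtrace_psd_ge0.
Qed.

Let trS1 : \tr (Q^t* *m rho *m Q) <= 1.
Proof.
have [t1 _] := prho; apply: le_trans t1; rewrite trS lerDr.
exact/mxtrace_psd_ge0/pd_psd.
Qed.

Let VVle : loewner (V *m V^t*) 1%:M.
Proof.
rewrite /loewner; have <- : Q^t* *m Q = 1%:M - V *m V^t*; last exact: psd_gram.
rewrite Qadj -/Q {1}/Q mulmxBl mul1mx /Q mulmxBr mulmx1.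
by rewrite mulmxA -[_ *m V^t* *m V]mulmxA VV mulmx1 subrr subr0.
Qed.

(** One inequality embeds [tau] by [V] and restores [rho] by taking the complementary corner
    [Q^t* *m rho *m Q] as [sigma]; the other compresses [rho] exactly to [tau], with [sigma = 0]. *)
Lemma N_isometry Z : N rho (V *m Z *m V^t*) = N tau Z.
Proof.
apply/le_anti/andP; split.
  rewrite {1}defS; apply: monotone1 => //; rewrite ?VV.
  - exact: loewner_refl.
  - exact: pstate_isometry.
  - by rewrite -defS.
have := @monotone1 n m (V^t*) (V *m Z *m V^t*) rho 0 n0 m0.
rewrite !trmxCK addr0 -deftau mxtrace0.
have -> : V^t* *m (V *m Z *m V^t*) *m V = Z.
  by rewrite -!mulmxA VV mulmx1 mulmxA VV mul1mx.
by apply=> //; [apply: psd0 | apply: pstate_isometry].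
Qed.

(** The pinching by [P = V V^*], with the complementary corner of [rho] as [sigma], fixes [rho] and
    [V Z V^*] and kills [Y]. So [V Z V^*] has least norm on the line through it in direction [Y]. *)
Lemma K_isometry_orth Z Y : V^t* *m Y *m V = 0 -> K rho (V *m Z *m V^t*) Y = 0.
Proof.
move=> VY; apply: (orthogonal_of_min (K_inner n0 prho)) => a.
set P := V *m V^t*.
have PP : P *m P = P by rewrite /P mulmxA -[_ *m V^t* *m V]mulmxA VV mulmx1.
have Padj : P^t* = P by rewrite adjmxM trmxCK.
have PZ : P *m (V *m Z *m V^t* + a *: Y) *m P^t* = V *m Z *m V^t*.
  rewrite Padj mulmxDr mulmxDl -scalemxAr -scalemxAl.
  have -> : P *m Y *m P = V *m (V^t* *m Y *m V) *m V^t* by rewrite /P !mulmxA.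
  rewrite VY mulmx0 mul0mx scaler0 addr0 /P !mulmxA -[_ *m V^t* *m V]mulmxA VV.
  by rewrite mulmx1 -[V *m V^t* *m V]mulmxA VV mulmx1.
have Pr : P *m rho *m P^t* = V *m tau *m V^t*.
  by rewrite Padj deftau /P !mulmxA.
have := @monotone1 n n P (V *m Z *m V^t* + a *: Y) rho (Q^t* *m rho *m Q) n0 n0.
rewrite PZ Pr -defS Padj PP; exact.
Qed.

End Isometry.

Definition injl n m : 'M[C]_(n + m, n) := col_mx 1%:M 0.

Definition injr n m : 'M[C]_(n + m, m) := col_mx 0 1%:M.

Lemma block_inl n m (X : 'M[C]_n) :
  (injl n m) *m X *m (injl n m)^t* = block_mx X 0 0 0.
Proof.
rewrite /injl /injr tr_col_mx map_row_mx adjmx1 adjmx0 mul_col_mx mul1mx mul0mx mul_col_row.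
by rewrite !mulmx1 !mulmx0.
Qed.

Lemma block_inr n m (X : 'M[C]_m) :
  (injr n m) *m X *m (injr n m)^t* = block_mx 0 0 0 X.
Proof.
rewrite /injl /injr tr_col_mx map_row_mx adjmx1 adjmx0 mul_col_mx mul1mx mul0mx mul_col_row.
by rewrite !mulmx1 !mulmx0.
Qed.

Lemma block_prl n m (A : 'M[C]_n) (B : 'M[C]_m) D E :
  (injl n m)^t* *m block_mx A D E B *m injl n m = A.
Proof.
rewrite /injl /injr tr_col_mx map_row_mx adjmx1 adjmx0 mul_row_block mul_row_col.
by rewrite !mul1mx !mul0mx !addr0 mulmx1 mulmx0 addr0.
Qed.

Lemma block_prr n m (A : 'M[C]_n) (B : 'M[C]_m) D E :
  (injr n m)^t* *m block_mx A D E B *m injr n m = B.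
Proof.
rewrite /injl /injr tr_col_mx map_row_mx adjmx1 adjmx0 mul_row_block mul_row_col.
by rewrite !mul1mx !mul0mx !add0r mulmx1 mulmx0 add0r.
Qed.

Lemma inl_isometry n m :
  (injl n m)^t* *m injl n m = 1%:M.
Proof. by rewrite /injl /injr tr_col_mx map_row_mx mul_row_col adjmx1 mulmx1 mulmx0 addr0. Qed.

Lemma inr_isometry n m :
  (injr n m)^t* *m injr n m = 1%:M.
Proof. by rewrite /injl /injr tr_col_mx map_row_mx mul_row_col adjmx1 mulmx1 mulmx0 add0r. Qed.

Lemma N_direct_sum n m (rho : 'M[C]_n) (sigma : 'M[C]_m) X Y :
  (0 < n)%N -> (0 < m)%N -> pstate (block_mx rho 0 0 sigma) ->
  N (block_mx rho 0 0 sigma) (block_mx X 0 0 Y) = N rho X + N sigma Y.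
Proof.
move=> n0 m0 pb; have nm0 : (0 < n + m)%N by rewrite addn_gt0 n0.
have ik := K_inner nm0 pb.
have r1 : block_mx rho 0 0 sigma *m injl n m = injl n m *m rho.
  by rewrite /injl /injr mul_block_col mul_col_mx !mulmx1 !mulmx0 !mul1mx !mul0mx !addr0.
have r2 : block_mx rho 0 0 sigma *m injr n m = injr n m *m sigma.
  by rewrite /injl /injr mul_block_col mul_col_mx !mulmx1 !mulmx0 !mul1mx !mul0mx !add0r.
have dX : block_mx X 0 0 Y = block_mx X 0 0 0 + 1 *: block_mx 0 0 0 Y.
  by rewrite scale1r add_block_mx !addr0 add0r.
rewrite /N dX (inner_expand ik) [K _ (block_mx 0 0 0 Y) _](innerC ik).
have -> : K (block_mx rho 0 0 sigma) (block_mx X 0 0 0) (block_mx 0 0 0 Y) = 0.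
  rewrite -block_inl; apply: K_isometry_orth r1 _ _ _ => //.
    exact: inl_isometry.
  exact: block_prl.
rewrite conjC0 conjC1 !mulr0 !addr0 !mul1r -block_inl -block_inr.
congr (_ + _).
  by apply: N_isometry r1 _ => //; apply: inl_isometry.
by apply: N_isometry r2 _ => //; apply: inr_isometry.
Qed.

(** * Homogeneity of the metric in the state *)

Lemma pstateZ n (rho : 'M[C]_n) t : 0 < t -> t <= 1 -> pstate rho -> pstate (t *: rho).
Proof.
move=> t0 t1 [tr1 prho]; split; last exact: pdZ.
have tr0 := mxtrace_psd_ge0 (pd_psd prho).
by rewrite mxtraceZ mulr_ile1 // ltW.
Qed.

Lemma scalemx3 m n q r (a b c : C) (A : 'M[C]_(m, n)) (B : 'M[C]_(n, q)) (D : 'M[C]_(q, r)) :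
  (a *: A) *m (b *: B) *m (c *: D) = (c * (a * b)) *: (A *m B *m D).
Proof.
by rewrite -scalemxAr -[(a *: A) *m _]scalemxAl -scalemxAr -!scalemxAl !scalerA mulrA.
Qed.

Lemma N_add n (rho X : 'M[C]_n) s t : (0 < n)%N -> pstate rho ->
  0 < s -> 0 < t -> s + t <= 1 ->
  N ((s + t) *: rho) ((s + t) *: X) = N (s *: rho) (s *: X) + N (t *: rho) (t *: X).
Proof.
move=> n0 prho s0 t0 st1; have st0 : 0 < s + t by rewrite addr_gt0.
have [tr1 pdr] := prho.
have pst := pstateZ st0 st1 prho.
have nn0 : (0 < n + n)%N by rewrite addn_gt0 n0.
have pb : pstate (block_mx (s *: rho) 0 0 (t *: rho)).
  split; last by apply: pd_block; apply: pdZ.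
  by have [] := pst; rewrite mxtrace_block !mxtraceZ mulrDl.
rewrite -N_direct_sum //; apply/le_anti/andP; split.
  have dsum Y : (injl n n)^t* *m block_mx (s *: Y) 0 0 (t *: Y) *m (injl n n)^t*^t* +
      (injr n n)^t* *m block_mx (s *: Y) 0 0 (t *: Y) *m (injr n n)^t*^t* = (s + t) *: Y.
    by rewrite !trmxCK block_prl block_prr scalerDl.
  rewrite -(dsum X).
  apply: monotone2 => //; rewrite !trmxCK //.
  have := @block_inl n n 1%:M; have := @block_inr n n 1%:M; rewrite !mulmx1 => -> ->.
  rewrite add_block_mx.
  by rewrite !addr0 add0r -scalar_mx_block.
(* Square roots of the proportions: the two Kraus operators together preserve the trace and carry
   [(s + t) Y] to the blocks [s Y] and [t Y]. *)
pose a := sqrtC (s / (s + t)); pose b := sqrtC (t / (s + t)).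
have a2 : a^* * a = s / (s + t).
  by rewrite conj_Creal -?expr2 ?sqrtCK // ger0_real // sqrtC_ge0 divr_ge0 ?ltW.
have b2 : b^* * b = t / (s + t).
  by rewrite conj_Creal -?expr2 ?sqrtCK // ger0_real // sqrtC_ge0 divr_ge0 ?ltW.
have st_n0 : s + t != 0 by rewrite gt_eqF.
have blk Y : (a *: injl n n) *m ((s + t) *: Y) *m (a *: injl n n)^t* +
    (b *: injr n n) *m ((s + t) *: Y) *m (b *: injr n n)^t* =
    block_mx (s *: Y) 0 0 (t *: Y).
  rewrite !adjmxZ !scalemx3 block_inl block_inr !scale_block_mx !scaler0.
  by rewrite add_block_mx !addr0 !add0r !mulrA a2 b2 !divfK.
rewrite -(blk X); apply: monotone2 => //.
rewrite !adjmxZ -!scalemxAl -!scalemxAr !scalerA inl_isometry inr_isometry.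
by rewrite a2 b2 -scalerDl -mulrDl divff // scale1r.
Qed.

(** For [phi t = N (t rho) (t X)], the linearity [phi t = t * phi 1] reads
    [t^2 N (t rho) X = t N rho X]. *)
Lemma N_scale_le1 n (rho X : 'M[C]_n) t : (0 < n)%N -> pstate rho ->
  0 < t -> t <= 1 -> N (t *: rho) X = t^-1 * N rho X.
Proof.
move=> n0 prho t0 t1.
have ge0 s : 0 < s -> s <= 1 -> 0 <= N (s *: rho) (s *: X).
  by move=> s0 s1; apply: inner_ge0; apply: K_inner => //; apply: pstateZ.
have := additive_nonneg_linear arch ge0 (fun s u s0 u0 => N_add X n0 prho s0 u0) t0 t1.
rewrite !scale1r /N (innerZ2 (K_inner n0 (pstateZ t0 t1 prho))) ger0_norm ?ltW //.
have tn0 : t != 0 by rewrite gt_eqF.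
by rewrite expr2 -mulrA => /(mulfI tn0) <-; rewrite mulrA mulVf // mul1r.
Qed.

Lemma N_scale n (rho X : 'M[C]_n) c : (0 < n)%N -> 0 < c -> pstate rho ->
  pstate (c *: rho) -> N (c *: rho) X = c^-1 * N rho X.
Proof.
move=> n0 c0 prho pc; have cn0 : c != 0 by rewrite gt_eqF.
have [c1|c1] := real_leP (gtr0_real c0) (@real1 C); first exact: N_scale_le1.
have := @N_scale_le1 _ (c *: rho) X c^-1 n0 pc.
rewrite scalerA mulVf // scale1r invrK => -> //; last by rewrite invf_le1 // ltW.
  by rewrite mulrA mulVf // mul1r.
by rewrite invr_gt0.
Qed.

(** * Diagonal states: restriction to coordinates and orthogonality of matrix units *)

Definition selmx n m (s : 'I_m -> 'I_n) : 'M[C]_(n, m) :=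
  \matrix_(a, b) (a == s b)%:R.

Lemma selmx_adjM n m q (s : 'I_m -> 'I_n) (Y : 'M[C]_(n, q)) :
  (selmx s)^t* *m Y = \matrix_(b, c) Y (s b) c.
Proof.
apply/matrixP => b c; rewrite !mxE (bigD1 (s b)) //= !mxE eqxx conjC1 mul1r.
rewrite big1 ?addr0 // => a /negPf ab; by rewrite !mxE ab conjC0 mul0r.
Qed.

Lemma mulmx_sel n m q (s : 'I_m -> 'I_n) (Y : 'M[C]_(q, n)) :
  Y *m selmx s = \matrix_(a, b) Y a (s b).
Proof.
apply/matrixP => a b; rewrite !mxE (bigD1 (s b)) //= !mxE eqxx mulr1.
by rewrite big1 ?addr0 // => c /negPf cb; rewrite !mxE cb mulr0.
Qed.

Lemma selmx_isometry n m (s : 'I_m -> 'I_n) : injective s ->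
  (selmx s)^t* *m selmx s = 1%:M.
Proof.
by move=> inj_s; rewrite selmx_adjM; apply/matrixP => a b; rewrite !mxE (inj_eq inj_s).
Qed.

Lemma mulmx_delta m n q r (A : 'M[C]_(m, n)) (B : 'M[C]_(q, r)) a b i j :
  (A *m delta_mx a b *m B) i j = A i a * B b j.
Proof.
by rewrite -(mul_delta_mx (0 : 'I_1)) mulmxA -colE -mulmxA -rowE mxE big_ord1 !mxE.
Qed.

Lemma selmx_delta n m (s : 'I_m -> 'I_n) a b :
  selmx s *m delta_mx a b *m (selmx s)^t* = delta_mx (s a) (s b).
Proof.
by apply/matrixP => i j; rewrite mulmx_delta !mxE conjC_nat -natrM mulnb.
Qed.

(** Coordinate subspaces reduce every diagonal matrix, which is what makes the results on isometries
    applicable to [selmx s] for injective [s]. *)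
Lemma rdiag_sel n m (s : 'I_m -> 'I_n) (p : 'I_n -> C) :
  rdiag p *m selmx s = selmx s *m rdiag (fun b => p (s b)).
Proof.
rewrite mul_mx_diag mul_diag_mx; apply/matrixP => a b; rewrite !mxE.
by case: eqVneq => [->|_]; rewrite ?mulr0 ?mul0r // mulr1 mul1r.
Qed.

Section Diagonal.
Variables (n : nat) (p : 'I_n -> C).
Hypotheses (n0 : (0 < n)%N) (pp : pstate (rdiag p)).

Let ik := K_inner n0 pp.

Lemma N_sel m (s : 'I_m -> 'I_n) a b : (0 < m)%N -> injective s ->
  N (rdiag p) (delta_mx (s a) (s b)) = N (rdiag (fun b => p (s b))) (delta_mx a b).
Proof.
move=> m0 inj_s; rewrite -selmx_delta.
exact: N_isometry n0 m0 (selmx_isometry inj_s) pp (rdiag_sel s p) _.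
Qed.

Lemma K_sel_orth m (s : 'I_m -> 'I_n) a b (Y : 'M[C]_n) : (0 < m)%N -> injective s ->
  (forall c d, Y (s c) (s d) = 0) -> K (rdiag p) (delta_mx (s a) (s b)) Y = 0.
Proof.
move=> m0 inj_s Y0; rewrite -selmx_delta.
apply: (K_isometry_orth n0 (selmx_isometry inj_s) pp (rdiag_sel s p)).
by rewrite selmx_adjM mulmx_sel; apply/matrixP => c d; rewrite !mxE.
Qed.

(* Conjugation by a diagonal unitary multiplies [delta_mx i j] by ['i] and
   [delta_mx j i] by [- 'i]. *)
Lemma K_swap_orth i j : i != j -> K (rdiag p) (delta_mx i j) (delta_mx j i) = 0.
Proof.
move=> ij; apply: (orthogonal_of_sym ik) => a.
pose u k : C := if k == i then 'i else 1.
have Uadj : (rdiag u)^t* = rdiag (fun k => if k == i then - 'i else 1).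
  apply/matrixP => k l; rewrite !mxE eq_sym; case: eqVneq => [->|_].
    by rewrite !mulr1n /u; case: ifP; rewrite ?conjCi ?conjC1.
  by rewrite !mulr0n conjC0.
have uU : (rdiag u)^t* *m rdiag u = 1%:M.
  rewrite Uadj rdiagM rdiag1 // => k; rewrite /u; case: ifP => _; last by rewrite mulr1.
  by rewrite mulNr -expr2 sqrCi opprK.
have comm : rdiag p *m rdiag u = rdiag u *m rdiag p.
  by rewrite !rdiagM /rdiag; congr diag_mx; apply/rowP => k; rewrite !mxE mulrC.
have := N_isometry n0 n0 uU pp comm (delta_mx i j - a *: delta_mx j i).
have -> : rdiag u *m (delta_mx i j - a *: delta_mx j i) *m (rdiag u)^t* =
    'i *: (delta_mx i j + a *: delta_mx j i).
  rewrite Uadj mul_mx_diag mul_diag_mx; apply/matrixP => k l; rewrite !mxE /u.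
  case: (eqVneq k i) => [->|ki]; case: (eqVneq l i) => [->|li];
    rewrite ?eqxx ?(negPf ij) ?[i == j]eq_sym ?(negPf ij) /= ?andbF ?andbT;
    rewrite ?mulr0 ?mulr0n ?subr0 ?addr0 ?sub0r ?add0r ?mulr0 ?mul0r ?mulr1 //.
    by rewrite mul1r mulrNN mulrC.
by rewrite /N (innerZ2 ik) normCi expr1n mul1r.
Qed.

Lemma K_delta_orth i j (Y : 'M[C]_n) : Y i j = 0 -> K (rdiag p) (delta_mx i j) Y = 0.
Proof.
have diag_orth k (Z : 'M[C]_n) : Z k k = 0 -> K (rdiag p) (delta_mx k k) Z = 0.
  move=> Zk; apply: (@K_sel_orth 1 (fun _ => k) 0 0) => // c d _.
  by rewrite !ord1.
have [<-|ij] := eqVneq i j; first exact: diag_orth.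
move=> Yij; pose s (b : 'I_2) := if b == 0 then i else j.
have inj_s : injective s.
  move=> [[|[|//]] ?] [[|[|//]] ?]; rewrite /s /= => h; apply: val_inj => //=.
    by move: ij; rewrite h eqxx.
  by move: ij; rewrite h eqxx.
(* Clear the corner on the coordinates [i], [j]. The remainder is orthogonal by restriction to that
   corner, the two diagonal units by restriction to one coordinate, and [delta_mx j i] by
   [K_swap_orth]. *)
pose Y1 := Y - (Y i i *: delta_mx i i + (Y j j *: delta_mx j j + Y j i *: delta_mx j i)).
have Y1s c d : Y1 (s c) (s d) = 0.
  rewrite !mxE /s; have ji : (j == i) = false by rewrite eq_sym (negPf ij).
  case: (c == 0) => /=; case: (d == 0) => /=; rewrite !(eqxx, ji, negPf ij) /=;
    by rewrite ?Yij !(mulr0, mulr1, addr0, add0r, subrr) ?oppr0.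
have dY : Y = Y1 + (Y i i *: delta_mx i i + (Y j j *: delta_mx j j + Y j i *: delta_mx j i)).
  by rewrite subrK.
have KY1 : K (rdiag p) (delta_mx i j) Y1 = 0 by apply: (@K_sel_orth 2 s 0 1).
rewrite [X in K _ _ X]dY (innerDr ik) KY1 add0r !(innerDr ik) !(innerZr ik).
rewrite (K_swap_orth ij) [K _ _ (delta_mx i i)](innerC ik).
rewrite [K _ _ (delta_mx j j)](innerC ik).
rewrite !diag_orth ?mxE ?eqxx ?(negPf ij) ?[j == i]eq_sym ?(negPf ij) ?andbF //.
by rewrite conjC0 !mulr0 !addr0.
Qed.

Lemma K_rdiag_wform X Y : K (rdiag p) X Y =
  wform (fun i j => N (rdiag p) (delta_mx i j)) X Y.
Proof.
have Kdelta i j : K (rdiag p) (delta_mx i j) Y = N (rdiag p) (delta_mx i j) * Y i j.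
  have {1}-> : Y = Y i j *: delta_mx i j + (Y - Y i j *: delta_mx i j).
    by rewrite addrC subrK.
  have Y0 : (Y - Y i j *: delta_mx i j) i j = 0 by rewrite !mxE !eqxx mulr1 subrr.
  by rewrite (innerDr ik) (innerZr ik) (K_delta_orth Y0) addr0 mulrC.
have addl : {morph (fun Z => K (rdiag p) Z Y) : U V / U + V >-> U + V}.
  by move=> U V; apply: (innerDl ik).
rewrite [X in K _ X _]matrix_sum_delta (big_morph _ addl (inner0l ik Y)).
apply: eq_bigr => i _; rewrite (big_morph _ addl (inner0l ik Y)).
apply: eq_bigr => j _; rewrite (innerZl ik) Kdelta; ring.
Qed.

End Diagonal.

(** * The function determined by a metric *)

Lemma mxtrace_rdiag n (p : 'I_n -> C) : \tr (rdiag p) = \sum_i p i.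
Proof. by rewrite mxtrace_diag; apply: eq_bigr => i _; rewrite mxE. Qed.

Definition pair2 (a b : C) (i : 'I_2) : C := if i == 0 then a else b.

Lemma pstate_pair2 a b : 0 < a -> 0 < b -> a + b <= 1 -> pstate (rdiag (pair2 a b)).
Proof.
move=> a0 b0 ab; split; first by rewrite mxtrace_rdiag big_ord_recl big_ord1.
by apply: pd_rdiag => i; rewrite /pair2; case: ifP.
Qed.

Definition kernel2 a b : C := N (rdiag (pair2 a b)) (delta_mx 0 1).

(* By homogeneity the metric at [diag(a, b)] is determined by that at the
   normalized pair proportional to [(a / b, 1)]; see [kernel2E]. *)
Definition density (z : C) : C := (z + 1) / kernel2 (z / (z + 1)) (1 / (z + 1)).

Lemma delta_mx_neq0 m n i j : delta_mx i j != 0 :> 'M[C]_(m, n).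
Proof. by apply/eqP => /matrixP/(_ i j)/eqP; rewrite !mxE !eqxx oner_eq0. Qed.

Lemma kernel2_gt0 a b : 0 < a -> 0 < b -> a + b <= 1 -> 0 < kernel2 a b.
Proof.
move=> a0 b0 ab; have [_ _ _] := @K_inner 2 _ isT (pstate_pair2 a0 b0 ab).
by apply; apply: delta_mx_neq0.
Qed.

Lemma normalized_pair (z : C) : 0 < z ->
  [/\ 0 < z / (z + 1), 0 < 1 / (z + 1) & z / (z + 1) + 1 / (z + 1) = 1].
Proof.
move=> z0; have z1 : 0 < z + 1 by rewrite addr_gt0.
by rewrite !divr_gt0 // -mulrDl divff // gt_eqF.
Qed.

Lemma density_gt0 z : 0 < z -> 0 < density z.
Proof.
move=> z0; have [a0 b0 ab] := normalized_pair z0.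
by rewrite divr_gt0 ?addr_gt0 // kernel2_gt0 // ab.
Qed.

Lemma kernel2E a b : 0 < a -> 0 < b -> a + b <= 1 ->
  kernel2 a b = (b * density (a / b))^-1.
Proof.
move=> a0 b0 ab; set z := a / b; have z0 : 0 < z by rewrite divr_gt0.
have [u0 v0 uv] := normalized_pair z0.
have bn0 : b != 0 by rewrite gt_eqF.
have ab0 : 0 < a + b by rewrite addr_gt0.
have abn0 : a + b != 0 by rewrite gt_eqF.
have z1 : z + 1 = (a + b) / b by rewrite /z mulrDl divff.
have uv1 : z / (z + 1) + 1 / (z + 1) <= 1 by rewrite uv.
(* Rescaling by [a + b] reaches the pair of trace one with the same ratio, where [density] reads off
   the metric. *)
have E : rdiag (pair2 a b) = (a + b) *: rdiag (pair2 (z / (z + 1)) (1 / (z + 1))).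
  rewrite rdiagZ /rdiag; congr diag_mx; apply/rowP => i; rewrite !mxE /pair2 z1 /z.
  by case: ifP => _; field; rewrite bn0 abn0.
have k0 := kernel2_gt0 u0 v0 uv1.
rewrite /kernel2 E N_scale //; last by rewrite -E; apply: pstate_pair2.
  rewrite -/(kernel2 _ _) /density z1; move: k0; rewrite z1; set k := kernel2 _ _ => k0.
  by field; rewrite bn0 abn0 gt_eqF.
exact: pstate_pair2.
Qed.

Lemma eq_rdiag n (p q : 'I_n -> C) : (forall i, p i = q i) -> rdiag p = rdiag q.
Proof. by move=> pq; rewrite /rdiag; congr diag_mx; apply/rowP => i; rewrite !mxE. Qed.

(* At [h 1] the off-diagonal unit [delta_mx 0 1] is carried by the rotation of
   cosine 3/5 to a matrix with nonzero diagonal, which compares the two kinds of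
   weights. *)
Lemma kernel1_half h : 0 < h -> h + h <= 1 ->
  N (rdiag (fun _ : 'I_1 => h)) (delta_mx 0 0) = kernel2 h h.
Proof.
move=> h0 hh; set w1 := N _ _; set k := kernel2 h h.
pose r := rdiag (fun _ : 'I_2 => h).
have rE : r = rdiag (pair2 h h) by apply: eq_rdiag => i; rewrite /pair2; case: ifP.
have pr : pstate r by rewrite rE; apply: pstate_pair2.
have inj1 (a : 'I_2) : injective (fun _ : 'I_1 => a) by move=> x y _; rewrite !ord1.
have wd (a : 'I_2) : N r (delta_mx a a) = w1.
  exact: (@N_sel 2 (fun _ => h) isT pr 1 (fun _ => a) 0 0 isT (@inj1 a)).
have w01 : N r (delta_mx 0 1) = k by rewrite rE.
have w10 : N r (delta_mx 1 0) = k.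
  pose s (b : 'I_2) : 'I_2 := if b == 0 then 1 else 0.
  have inj_s : injective s.
    by move=> [[|[|//]] ?] [[|[|//]] ?]; rewrite /s /= => h'; apply: val_inj.
  have := @N_sel 2 (fun _ => h) isT pr 2 s 0 1 isT inj_s.
  by rewrite -w01.
have [c [d [cr dr cd cdn0]]] : exists c d : C,
    [/\ c^* = c, d^* = d, c * c + d * d = 1 & c * d != 0].
  exists (3%:R / 5%:R), (4%:R / 5%:R); split.
  - by rewrite conj_Creal // rpred_div ?realn.
  - by rewrite conj_Creal // rpred_div ?realn.
  - by field.
  by rewrite !mulf_neq0 ?invr_eq0 ?pnatr_eq0.
pose U : 'M[C]_2 := \matrix_(i, j) (if i == j then c else if i == 0 then d else - d).
have UU : U^t* *m U = 1%:M.
  apply/matrixP => -[[|[|//]] ?] [[|[|//]] ?]; rewrite !mxE big_ord_recl big_ord1 !mxE /=;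
    rewrite ?conjCN ?cr ?dr; [rewrite -cd|..|rewrite -cd]; ring.
have comm : r *m U = U *m r by rewrite /r -scalar_rdiag scalar_mxC.
have := N_isometry (isT : (0 < 2)%N) (isT : (0 < 2)%N) UU pr comm (delta_mx 0 1).
rewrite w01 {1}/N (@K_rdiag_wform 2 (fun _ => h) isT pr).
have -> : U *m delta_mx 0 1 *m U^t* = \matrix_(i, j) (U i 0 * (U j 1)^*).
  by apply/matrixP => i j; rewrite mulmx_delta !mxE.
rewrite /wform !big_ord_recl !big_ord0 !mxE /= -/r.
have -> : lift 0 0 = 1 :> 'I_2 by apply: val_inj.
rewrite !wd w01 w10 ?conjCM ?conjCN ?conjCK ?cr ?dr => e.
(* Invariance under the rotation gives [2 (c d)^2 w1 + (c^4 + d^4) k = k]. Since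
   [(c^2 + d^2)^2 = 1], this says [2 (c d)^2 w1 = 2 (c d)^2 k]. *)
apply: (mulfI (_ : 2%:R * (c * d) ^+ 2 != 0)).
  by rewrite mulf_neq0 ?expf_neq0 ?pnatr_eq0.
have h1 : 2%:R * (c * d) ^+ 2 * w1 + (c ^+ 4 + d ^+ 4) * k = k.
  by rewrite -[RHS]e; ring.
have -> : 2%:R * (c * d) ^+ 2 * w1 =
    2%:R * (c * d) ^+ 2 * w1 + (c ^+ 4 + d ^+ 4) * k - (c ^+ 4 + d ^+ 4) * k by ring.
have -> : 2%:R * (c * d) ^+ 2 * k = (c * c + d * d) ^+ 2 * k - (c ^+ 4 + d ^+ 4) * k by ring.
by rewrite h1 cd expr1n mul1r.
Qed.

(** [kernel1_half] needs room for two copies of the eigenvalue within trace one, so it is used at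
    [a / 2] and homogeneity doubles the state. *)
Lemma kernel1E a : 0 < a -> a <= 1 ->
  N (rdiag (fun _ : 'I_1 => a)) (delta_mx 0 0) = (a * density 1)^-1.
Proof.
move=> a0 a1; pose h := a / 2%:R.
have h0 : 0 < h by rewrite divr_gt0 ?ltr0n.
have ha : 2%:R * h = a by rewrite /h mulrC divfK // pnatr_eq0.
have hh : h + h <= 1 by rewrite -mulr2n -mulr_natl ha.
have E : rdiag (fun _ : 'I_1 => a) = 2%:R *: rdiag (fun _ => h).
  by rewrite rdiagZ; apply: eq_rdiag => i; rewrite ha.
have p1 b : 0 < b -> b <= 1 -> pstate (rdiag (fun _ : 'I_1 => b)).
  by move=> b0 b1; split; [rewrite mxtrace_rdiag big_ord1 | apply: pd_rdiag].
rewrite E N_scale ?ltr0n //; last by rewrite -E; apply: p1.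
  rewrite kernel1_half // kernel2E // divff ?gt_eqF // -ha.
  by rewrite -mulrA [RHS]invfM.
by apply: p1 => //; apply: le_trans hh; rewrite lerDl ltW.
Qed.

(** Restricting to the coordinates [i] and [j] leaves one eigenvalue, covered by [kernel1E], or two,
    covered by [kernel2E]. *)
Lemma N_delta n (p : 'I_n -> C) i j : (0 < n)%N -> (forall i, 0 < p i) ->
  pstate (rdiag p) -> N (rdiag p) (delta_mx i j) = mweight density p i j.
Proof.
move=> n0 p0 pp; have [trp _] := pp; rewrite mxtrace_rdiag in trp.
rewrite /mweight; have [<-|ij] := eqVneq i j.
  have inj1 : injective (fun _ : 'I_1 => i) by move=> x y _; rewrite !ord1.
  rewrite (@N_sel n p n0 pp 1 (fun _ => i) 0 0 isT inj1) kernel1E ?divff ?gt_eqF //.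
  by apply: le_trans trp; rewrite (bigD1 i) //= lerDl sumr_ge0 // => k _; apply: ltW.
pose s (b : 'I_2) := if b == 0 then i else j.
have inj_s : injective s.
  move=> [[|[|//]] ?] [[|[|//]] ?]; rewrite /s /= => h; apply: val_inj => //=.
    by move: ij; rewrite h eqxx.
  by move: ij; rewrite h eqxx.
rewrite (@N_sel n p n0 pp 2 s 0 1 isT inj_s) -kernel2E //; last first.
  apply: le_trans trp; rewrite (bigD1 i) //= (bigD1 j) 1?eq_sym //= addrA lerDl.
  by apply: sumr_ge0 => k _; apply: ltW.
rewrite /kernel2; congr (N _ _); apply: eq_rdiag => b.
by rewrite /s /pair2; case: ifP.
Qed.

Lemma K_metric_form n (rho X Y : 'M[C]_n) : (0 < n)%N -> pstate rho ->
  K rho X Y = metric_form density rho X Y.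
Proof.
move=> n0 prho; have [_ pdr] := prho.
move: X Y; apply: (inner_product_eq (K_inner n0 prho) (metric_form_inner density_gt0 pdr)) => X.
have [U [p [uU p0 drho]]] := pd_spectral pdr.
have rU : rho *m U^t* = U^t* *m rdiag p by rewrite drho -!mulmxA unitaryC // mulmx1.
have uU' := unitary_adj uU.
have pp : pstate (rdiag p) := pstate_isometry uU' prho rU.
have {1 2}-> : X = U^t* *m (U *m X *m U^t*) *m (U^t*)^t*.
  by rewrite trmxCK !mulmxA uU mul1mx -mulmxA uU mulmx1.
rewrite -/(N _ _) (N_isometry n0 n0 uU' prho rU) /N (K_rdiag_wform n0 pp).
rewrite drho /metric_form (metric_operator_form uU _ _ density_gt0 p0).
by do 2![apply: eq_bigr => ? _]; rewrite N_delta.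
Qed.

(** * Operator monotonicity of the density *)

Lemma fcalc_mulV g n (A : 'M[C]_n) : (forall x, 0 < x -> 0 < g x) -> pdmx A ->
  fcalc (fun z => (g z)^-1) A *m fcalc g A = 1%:M.
Proof.
move=> g0 /pd_spectral[U [p [uU p0 ->]]].
have pr i : p i \is Num.real by rewrite gtr0_real.
rewrite !fcalc_rdiag // !mulmxA -[_ *m U *m U^t*]mulmxA unitaryC // mulmx1.
rewrite -[_ *m rdiag _ *m rdiag _]mulmxA rdiagM rdiag1 ?mulmx1 // => i.
by rewrite mulVf // gt_eqF // g0.
Qed.

Let bordered n t (A : 'M[C]_n) : 'M[C]_(n + 1) := t *: block_mx A 0 0 1%:M.

(** Between an eigenvector of [A] with eigenvalue [a_i] and the border, the state has eigenvalues
    [t a_i] and [t]. Their ratio is [a_i], so the weight is [(t density(a_i))^-1]. *)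
Lemma N_bordered n t (A : 'M[C]_n) x : 0 < t -> pdmx A -> pstate (bordered t A) ->
  N (bordered t A) (block_mx 0 x 0 0) =
  t^-1 * qform (fcalc (fun z => (density z)^-1) A) x.
Proof.
move=> t0 /pd_spectral[U [a [uU a0 dA]]] pb; have tn0 : t != 0 by rewrite gt_eqF.
have n10 : (0 < n + 1)%N by rewrite addn1.
pose r (k : 'I_(n + 1)) := match split k with inl i => t * a i | inr _ => t end.
have r0 k : 0 < r k by rewrite /r; case: split => // i; rewrite mulr_gt0.
pose W : 'M[C]_(n + 1) := block_mx U 0 0 1%:M.
have Wadj : W^t* = block_mx (U^t*) 0 0 1%:M.
  by rewrite /W tr_block_mx map_block_mx !adjmx0 adjmx1.
have uW : unitary W.
  rewrite /unitary Wadj mulmx_block !mulmx0 !mul0mx !addr0 !add0r uU mulmx1.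
  by rewrite -scalar_mx_block.
have rE : rdiag r = t *: block_mx (rdiag a) 0 0 1%:M.
  rewrite scale_block_mx !scaler0; apply/matrixP => k l.
  rewrite -[k]splitK -[l]splitK; case: (split k) => i; case: (split l) => j /=;
    rewrite ?block_mxEul ?block_mxEur ?block_mxEdl ?block_mxEdr !mxE.
  - by rewrite (inj_eq (@lshift_inj _ _)) /r (unsplitK (inl _)) mulrnAr.
  - by rewrite eq_lrshift.
  - by rewrite eq_rlshift.
  - by rewrite (inj_eq (@rshift_inj _ _)) /r (unsplitK (inr _)) mulr_natr.
have dB : bordered t A = W^t* *m rdiag r *m W.
  rewrite rE -scalemxAr -scalemxAl Wadj !mulmx_block !mulmx0 !mul0mx !addr0 !add0r.
  by rewrite !mul1mx ?mulmx1 ?mul0mx ?mulmx0 -dA.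
have WX : W *m block_mx 0 x 0 0 *m W^t* = block_mx 0 (U *m x) 0 0.
  rewrite Wadj !mulmx_block !mulmx0 !mul0mx !addr0 !add0r ?mulmx0 ?mul0mx ?mulmx1.
  by rewrite ?mulmx0 ?mul0mx ?addr0.
rewrite /N K_metric_form // /metric_form dB metric_operator_form //; last first.
  by move=> z; apply: density_gt0.
rewrite WX dA fcalc_rdiag //; last by move=> i; rewrite gtr0_real.
rewrite qform_congr qform_rdiag /wform big_split_ord /= big_ord1 mulr_sumr.
rewrite [X in _ + X]big1 => [|j _]; last first.
  by rewrite -[j]splitK; case: (split j) => k /=;
    rewrite ?block_mxEdl ?block_mxEdr mxE !mulr0.
rewrite addr0; apply: eq_bigr => i _.
rewrite big_split_ord /= big_ord1 big1 => [|j _]; last first.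
  by rewrite block_mxEul mxE mulr0 mulr0.
rewrite add0r block_mxEur /mweight /r (unsplitK (inl _)) (unsplitK (inr _)).
rewrite invfM [t * a i]mulrC mulfK // [_^* * _]mulrC -normCK.
by rewrite -[LHS]mulrA; congr (_ * _).
Qed.

Lemma density_opmonotone : opmonotone density.
Proof.
split=> [z|n A B n0 pA AB]; first exact: density_gt0.
split; first exact: (pd_fcalc density_gt0).
have pB : pdmx B.
  by move=> x x0; apply: lt_le_trans (pA x x0) _; move: x {x0}; apply/loewnerP.
pose G z := (density z)^-1.
have G0 z : 0 < z -> 0 < G z by move=> z0; rewrite invr_gt0 density_gt0.
have trB := mxtrace_pd_gt0 n0 pB.
have trB1 : 0 < \tr B + 1 by rewrite addr_gt0.
(* This [t] gives the bordered [B] trace one, so the bordered [A] is a substate too and their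
   difference [sigma] is admissible for the identity map. *)
pose t := (\tr B + 1)^-1; have t0 : 0 < t by rewrite invr_gt0.
have pdb M : pdmx M -> pdmx (bordered t M).
  by move=> pM; apply: pdZ => //; apply: pd_block => //; apply: pd_scalar.
pose sigma := bordered t B - bordered t A.
have psig : psdmx sigma.
  apply/(loewnerP (bordered t A)) => y; rewrite -[y]vsubmxK !qformZ !qform_block.
  by rewrite ler_pM2l // lerD2r; move: (usubmx y); apply/loewnerP.
have trs := mxtrace_psd_ge0 psig.
have trBB : \tr (bordered t B) = 1.
  by rewrite mxtraceZ mxtrace_block mxtrace1 mulVf // gt_eqF.
have trAB : \tr sigma = 1 - \tr (bordered t A) by rewrite raddfB /= trBB.
have sB : pstate (bordered t B) by split; [rewrite trBB | apply: pdb].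
have sA : pstate (bordered t A).
  by split; [rewrite -subr_ge0 -trAB | apply: pdb].
have trs1 : \tr sigma <= 1.
  by rewrite trAB lerBlDr lerDl mxtrace_psd_ge0 //; apply/pd_psd/pdb.
have n10 : (0 < n + 1)%N by rewrite addn1.
have GAB : loewner (fcalc G B) (fcalc G A).
  apply/loewnerP => x; have t0' : 0 < t^-1 by rewrite invr_gt0.
  rewrite -(ler_pM2l t0') -!N_bordered //.
  have := @monotone1 _ _ 1%:M (block_mx 0 x 0 0) (bordered t A) sigma n10 n10.
  rewrite adjmx1 !mul1mx !mulmx1 /sigma [bordered t A + _]addrC subrK; apply=> //.
  exact: loewner_refl.
(* With [S = 1], [loewner_dual] says that inversion reverses the order, turning the comparison of
   [1 / density] into that of [density]. *)
have := @loewner_dual C n n (fcalc G B) (fcalc density B) (fcalc G A) (fcalc density A) 1%:M.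
rewrite adjmx1 !mul1mx !mulmx1; apply=> //.
- by apply/pd_hermitian/pd_fcalc.
- by apply/pd_hermitian/pd_fcalc.
- by apply/pd_psd/pd_fcalc.
- exact: (fcalc_mulV density_gt0).
exact: (fcalc_mulV density_gt0).
Qed.

End MonotoneMetrics.

(** * Transfer to [R[i]] and to real functions *)

Section Specialization.
Context {R : realType}.
Local Notation C := R[i].

Lemma complex_archimedean (x : C) : 0 <= x -> exists n : nat, x < n%:R.
Proof.
move=> x0; exists (Num.bound (complex.Re x)).
have -> : x = ((complex.Re x)%:C)%C by rewrite RRe_real // ger0_real.
rewrite -(rmorph_nat (real_complex R)) ltcR.
have /archi_boundP : 0 <= complex.Re x by rewrite -ler0c RRe_real // ger0_real.
by [].
Qed.

(** Shaped so that [fcalc (lift_fun f)] is convertible to [funcalc f]; the matrix halves of the two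
    monotonicity notions then coincide by conversion. *)
Definition lift_fun (f : R -> R) (z : C) : C := ((f (complex.Re z))%:C)%C.

Lemma gt0_complex (z : C) : 0 < z -> exists2 x : R, 0 < x & z = (x%:C)%C.
Proof.
move=> z0; exists (complex.Re z); last by rewrite RRe_real // gtr0_real.
by rewrite -ltcR RRe_real // gtr0_real.
Qed.

Lemma opmonotone_lift f : operator_monotone f -> opmonotone (lift_fun f).
Proof.
move=> [f0 fm]; split; last exact: fm.
by move=> z /gt0_complex[x x0 ->]; rewrite /lift_fun ltcR f0.
Qed.

Lemma lift_opmonotone f : opmonotone (lift_fun f) -> operator_monotone f.
Proof.
move=> [f0 fm]; split; last exact: fm.
by move=> x x0; rewrite -ltcR; apply: (f0 (x%:C)%C); rewrite ltcR.
Qed.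

End Specialization.

(** * Functions that agree on positive arguments *)

Section Extensionality.
Context {C : numClosedFieldType}.
Variables g h : C -> C.
Hypothesis gh : forall z, 0 < z -> g z = h z.

Lemma eq_fcalc n (A : 'M[C]_n) : pdmx A -> fcalc g A = fcalc h A.
Proof.
move=> /pd_spectral[U [p [uU p0 ->]]].
have pr i : p i \is Num.real by rewrite gtr0_real.
by rewrite !fcalc_rdiag // (eq_rdiag (q := fun i => h (p i))) // => i; rewrite gh.
Qed.

Lemma eq_opmonotone : opmonotone g -> opmonotone h.
Proof.
move=> [g0 gm]; split=> [z z0|n A B n0 pA AB]; first by rewrite -gh // g0.
have pB : pdmx B.
  by move=> x x0; apply: lt_le_trans (pA x x0) _; move: x {x0}; apply/loewnerP.
by rewrite -!eq_fcalc //; apply: gm.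
Qed.

Lemma eq_metric_form n (rho X Y : 'M[C]_n) : (forall z, 0 < z -> 0 < g z) -> pdmx rho ->
  metric_form g rho X Y = metric_form h rho X Y.
Proof.
move=> g0 /pd_spectral[U [p [uU p0 ->]]].
have h0 z : 0 < z -> 0 < h z by move=> z0; rewrite -gh // g0.
rewrite /metric_form !metric_operator_form //.
by do 2![apply: eq_bigr => ? _]; rewrite /mweight gh // divr_gt0.
Qed.

End Extensionality.

Lemma metric_formE (R : realType) (f : R -> R) n (rho X Y : 'M[R[i]]_n) :
  \tr (X^t* *m superapp (invmx (metric_op f rho)) Y) = metric_form (lift_fun f) rho X Y.
Proof. by []. Qed.

Theorem theorem2p2 (R : realType)
  (K : forall n : nat, 'M[R[i]]_n -> 'M[R[i]]_n -> 'M[R[i]]_n -> R[i]) :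
  cptni_monotone_metrics K <->
  exists f : R -> R, operator_monotone f /\
    forall (n : nat) (rho X Y : 'M[R[i]]_n), (0 < n)%N -> pos_substate rho ->
      K n rho X Y = \tr (X^t* *m superapp (invmx (metric_op f rho)) Y).
Proof.
split=> [[K_inner K_mono]|[f [fm Kf]]].
  have mono : forall n m k (A : 'I_k -> 'M[R[i]]_(m, n)) (X rho : 'M[R[i]]_n) sigma,
      (0 < n)%N -> (0 < m)%N -> loewner (\sum_i (A i)^t* *m A i) 1%:M ->
      pstate rho -> \tr sigma <= 1 -> psdmx sigma -> pstate (kraus A rho + sigma) ->
      K m (kraus A rho + sigma) (kraus A X) (kraus A X) <= K n rho X X.
    move=> n m k A X rho sigma n0 m0 subA prho trs ps pw.
    by apply: K_mono => //; exists k, A.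
  have og := density_opmonotone complex_archimedean K_inner mono.
  have KE := K_metric_form complex_archimedean K_inner mono.
  have g0 := density_gt0 K_inner.
  (* [density K] is a function on [R[i]], real and positive on positive arguments. There it agrees
     with the lift of its real part, and the spectra at hand are positive. *)
  pose f x := complex.Re (density K (x%:C)%C).
  have gf (z : R[i]) : 0 < z -> density K z = lift_fun f z.
    move=> z0; have [x x0 ->] := gt0_complex z0.
    by rewrite /lift_fun /f RRe_real // gtr0_real // g0 // ltcR.
  exists f; split; first exact/lift_opmonotone/(eq_opmonotone gf og).
  move=> n rho X Y n0 prho; have pr : pdmx rho by case: prho.
  rewrite (KE _ _ _ _ n0 prho).
  by rewrite metric_formE (eq_metric_form gf X Y g0 pr).
have og := opmonotone_lift fm; have [g0 _] := og.
split=> [n rho n0 pr1|n m T X rho sigma n0 m0 [k [A [subA TA]]] pr ps pw].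
  have [_ pr] := pr1; apply: eq_inner_product (metric_form_inner g0 pr) => X Y.
  exact: (Kf n rho X Y n0 pr1).
have [_ pdr] := pr; have [_ pds] := ps; have [_ pdw] := pw.
rewrite (Kf m _ _ _ m0 pw) (Kf n _ _ _ n0 pr) !metric_formE !TA; rewrite TA in pdw.
exact: (metric_form_monotone X og m0 subA pdr pds pdw).
Qed.
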